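(* Every Schnorr random real $x\in[0,1]$ (a fortiori every Martin-Löf random real $x\in[0,1]$) is effective Koksma uniformly distributed; that is, for every effective Koksma sequence $(u_n)_{n\geq 1}$ of functions $[0,1]\to\mathbb{R}$, the sequence of reals $(u_n(x))_{n\geq 1}$ is uniformly distributed modulo $1$.
   Context: $\lambda$ denotes Lebesgue measure. A real $r$ is computable if there is a computable sequence of rationals $(q_k)_{k}$ with $|r-q_k|\leq 2^{-k}$ for all $k$; a sequence of reals is computable if this holds uniformly. A sequence $(f_n)_{n\geq1}$ of functions $[0,1]\to\mathbb{R}$ is computable if (in the usual sense of computable analysis) there is an algorithm which, given $n$, $k$ and oracle access to any sequence of rationals converging to $t\in[0,1]$ with error at most $2^{-j}$ at step $j$, outputs a rational within $2^{-k}$ of $f_n(t)$. Randomness. A Martin-Löf test is a sequence $(U_n)_{n\in\mathbb{N}}$ of decreasing open sets $U_n=\bigcup_{k\in\mathbb{N}} I_{n,k}$, where $(I_{n,k})_{n,k\in\mathbb{N}}$ is a computable sequence of open intervals with rational endpoints, such that the sequence $(\lambda(U_n))_{n\in\mathbb{N}}$ is upper-bounded by a computable function of $n$ which converges to zero. A real passes the test if it is not in all the $U_n$'s. A real is Martin-Löf random if it passes every Martin-Löf test. A Schnorr test is a Martin-Löf test such that the sequence of reals $(\lambda(U_n))_{n\in\mathbb{N}}$ is computable; a real is Schnorr random if it passes every Schnorr test. Uniform distribution. Write $\{y\}=y-\lfloor y\rfloor$ for the fractional part of a real $y$. A sequence $(x_n)_{n\geq1}$ of reals is uniformly distributed modulo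 $1$ if for every half-open interval $[a,b)$ in $[0,1]$, $\lim_{N\to\infty}\frac1N\#\{n:1\leq n\leq N,\ \{x_n\}\in[a,b)\}=b-a$. Koksma sequences. For $K>0$, a sequence $(u_n)_{n\geq1}$ of functions $u_n:[0,1]\to\mathbb{R}$ is $K$-Koksma if: every $u_n$ is continuously differentiable; for all $m,n$ the difference $u_m'-u_n'$ is a monotone function on $[0,1]$; and $|u_m'(t)-u_n'(t)|\geq K$ for all $m\neq n$ and all $t\in[0,1]$. It is Koksma if it is $K$-Koksma for some $K>0$. It is effective Koksma if it is Koksma, the sequence $(u_n)_{n\geq1}$ is computable, and the sequence of derivatives $(u_n')_{n\geq1}$ is also computable. *)

(* Defs.v *)
From HB Require Import structures.
From mathcomp Require Import all_boot all_order all_algebra.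
From mathcomp Require Import all_classical all_reals all_analysis.
Set Implicit Arguments.
Unset Strict Implicit.
Unset Printing Implicit Defensive.
Import Order.TTheory GRing.Theory Num.Theory.
Import numFieldNormedType.Exports.
Local Open Scope classical_set_scope.
Local Open Scope ring_scope.

(** Kleene's partial recursive functions with an oracle [o : nat -> nat].
    Programs take a list of naturals as arguments; [Proj i] returns the i-th
    argument, or 0 when it is absent. *)
Inductive code : Type :=
| Zero
| Succ
| Proj of nat
| Oracle
| Comp of code & seq code
| Prec of code & code
| Mu of code.

(** [eval_code o c v y]: the program [c] with oracle [o] halts on [v] with output
    [y]. In [Prec f g] the recursion variable comes first, and [g] receives it
    followed by the previous value; [Mu f] searches for the least [m] with
    [f (m :: v) = 0], all earlier values being defined and positive. *)
Inductive eval_code (o : nat -> nat) : code -> seq nat -> nat -> Prop :=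
| eval_Zero v : eval_code o Zero v 0%N
| eval_Succ x v : eval_code o Succ (x :: v) x.+1
| eval_Proj i v : eval_code o (Proj i) v (nth 0%N v i)
| eval_Oracle x v : eval_code o Oracle (x :: v) (o x)
| eval_Comp f gs v w y : eval_codes o gs v w -> eval_code o f w y ->
    eval_code o (Comp f gs) v y
| eval_Prec0 f g v y : eval_code o f v y -> eval_code o (Prec f g) (0%N :: v) y
| eval_PrecS f g n v z y : eval_code o (Prec f g) (n :: v) z ->
    eval_code o g [:: n, z & v] y -> eval_code o (Prec f g) (n.+1 :: v) y
| eval_Mu f v m (z : nat -> nat) :
    (forall i, (i < m)%N -> eval_code o f (i :: v) (z i).+1) ->
    eval_code o f (m :: v) 0%N -> eval_code o (Mu f) v m
with eval_codes (o : nat -> nat) : seq code -> seq nat -> seq nat -> Prop :=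
| evals_nil v : eval_codes o [::] v [::]
| evals_cons g gs v y w : eval_code o g v y -> eval_codes o gs v w ->
    eval_codes o (g :: gs) v (y :: w).

(** Oracle-free computation: the oracle is constantly 0. *)
Definition eval_code0 : code -> seq nat -> nat -> Prop := eval_code (fun=> 0%N).

(** Every rational has a code: [2 ^ a * 3 ^ b * 5 ^ d] denotes
    [(a - b) / (d + 1)]. *)
Definition decode_rat (m : nat) : rat :=
  ((logn 2 m)%:R - (logn 3 m)%:R) / (logn 5 m).+1%:R.

Definition computable_rat_seq2 (q : nat -> nat -> rat) : Prop :=
  exists c : code, forall n k : nat,
    exists2 m : nat, eval_code0 c [:: n; k] m & decode_rat m = q n k.

Definition computable_real_seq (R : realType) (r : nat -> R) : Prop :=
  exists2 q : nat -> nat -> rat, computable_rat_seq2 q &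
    forall n k : nat, `|r n - ratr (q n k)| <= 2 ^- k.

Definition oracle_for (R : realType) (o : nat -> nat) (t : R) : Prop :=
  forall j : nat, `|ratr (decode_rat (o j)) - t| <= 2 ^- j.

(** Sequences of functions on [0,1] are represented as [u : nat -> R -> R];
    only the values [u n t] with [1 <= n] and [0 <= t <= 1] are relevant. *)
Definition computable_fun_seq (R : realType) (u : nat -> R -> R) : Prop :=
  exists c : code, forall n k : nat, (1 <= n)%N ->
    forall t : R, t \in `[0, 1] -> forall o : nat -> nat, oracle_for o t ->
    exists2 m : nat, eval_code o c [:: n; k] m &
      `|u n t - ratr (decode_rat m)| <= 2 ^- k.

(** Derivatives of functions on [0,1] are one-sided at 0 and 1. *)
Definition diff_quot (R : realType) (f : R -> R) (t s : R) : R :=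
  (f s - f t) / (s - t).

Definition derivable01 (R : realType) (f : R -> R) (t : R) : Prop :=
  cvg (diff_quot f t @ within `[0, 1] t^').

Definition deriv01 (R : realType) (f : R -> R) (t : R) : R :=
  lim (diff_quot f t @ within `[0, 1] t^').

Definition continuously_differentiable01 (R : realType) (f : R -> R) : Prop :=
  (forall t : R, t \in `[0, 1] -> derivable01 f t) /\
  {within `[0, 1], continuous (deriv01 f)}.

Definition monotone01 (R : realType) (f : R -> R) : Prop :=
  {in `[0, 1] &, {homo f : s t / s <= t}} \/
  {in `[0, 1] &, {homo f : s t /~ s <= t}}.

Definition K_koksma (R : realType) (K : R) (u : nat -> R -> R) : Prop :=
  [/\ forall n : nat, (1 <= n)%N -> continuously_differentiable01 (u n),
      forall m n : nat, (1 <= m)%N -> (1 <= n)%N ->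
        monotone01 (fun t => deriv01 (u m) t - deriv01 (u n) t)
    & forall m n : nat, (1 <= m)%N -> (1 <= n)%N -> m <> n ->
        forall t : R, t \in `[0, 1] ->
          K <= `|deriv01 (u m) t - deriv01 (u n) t|].

Definition koksma (R : realType) (u : nat -> R -> R) : Prop :=
  exists2 K : R, 0 < K & K_koksma K u.

Definition effective_koksma (R : realType) (u : nat -> R -> R) : Prop :=
  [/\ koksma u, computable_fun_seq u
    & computable_fun_seq (fun n => deriv01 (u n))].

Definition frac_part (R : realType) (y : R) : R := y - (Num.floor y)%:~R.

Definition ud_mod1 (R : realType) (x : nat -> R) : Prop :=
  forall a b : R, 0 <= a -> a < b -> b <= 1 ->
    (fun N : nat =>
       (count (fun n => a <= frac_part (x n) < b) (iota 1 N))%:R / N%:R : R)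
      @ \oo --> b - a.

Definition effective_koksma_ud (R : realType) (x : R) : Prop :=
  forall u : nat -> R -> R, effective_koksma u -> ud_mod1 (fun n => u n x).

Definition martin_lof_test (R : realType) (U : nat -> set R) : Prop :=
  [/\ exists a b : nat -> nat -> rat,
        [/\ computable_rat_seq2 a, computable_rat_seq2 b,
            forall n k : nat, a n k < b n k
          & forall n : nat,
              U n = \bigcup_k [set` `]ratr (a n k), ratr (b n k)[ ] ],
      forall n : nat, U n.+1 `<=` U n
    & exists h : nat -> R,
        [/\ computable_real_seq h, h @ \oo --> (0 : R)
          & forall n : nat, (lebesgue_measure (U n) <= (h n)%:E)%E] ].

(** The measures are finite, being bounded, so that [fine] loses nothing. *)
Definition schnorr_test (R : realType) (U : nat -> set R) : Prop :=
  martin_lof_test U /\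
  computable_real_seq (fun n => fine (lebesgue_measure (U n))).

Definition passes_test (R : realType) (U : nat -> set R) (x : R) : Prop :=
  ~ (forall n : nat, U n x).

Definition martin_lof_random (R : realType) (x : R) : Prop :=
  forall U : nat -> set R, martin_lof_test U -> passes_test U x.

Definition schnorr_random (R : realType) (x : R) : Prop :=
  forall U : nat -> set R, schnorr_test U -> passes_test U x.

(* Main.v *)
Require Import Defs.
From mathcomp Require Import all_boot all_order all_algebra zify ring lra.
From mathcomp Require Import all_classical all_reals all_analysis.
Set Implicit Arguments.
Unset Strict Implicit.
Unset Printing Implicit Defensive.
Import Order.TTheory GRing.Theory Num.Theory.
Import numFieldNormedType.Exports.

(** Let [G y = {y}^2 - {y} + 1/6] be the second Bernoulli function. The energy
    [sum_{m,n < N} G (u_m x - u_n x)] is, for the sorted fractional parts, the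
    variance of their deviations from equally spaced points, so it is nonnegative,
    and it is [o(N^2)] along [N = M^4] only if [u_n x] is uniformly distributed
    modulo 1. On the other hand [G] has the bounded primitive [B3/3], so a discrete
    van der Corput estimate (Abel summation, using that [u_m' - u_n'] is monotone)
    bounds the average of [G (u_m t - u_n t)] over a fine grid of [t] by a multiple
    of [1/|u_m' - u_n'|] at the endpoints. Since the values [u_n' 0] are
    [K]-separated, and so are the [u_n' 1], the mean energy over the grid is
    [O(N^(3/2))]. By Markov's inequality the grid cells where it exceeds [eps N^2]
    have total length [O(M^-2)], which is summable with a computable rate. The
    energy is piecewise quadratic in rational approximations of [u_n t] modulo 1, so
    natural number arithmetic decides which cells to select, and the unions of the
    cells selected at late stages form a Schnorr test. *)

(** * Computable functions *)

(* A Schnorr test must have computable measures, so the selection of a cell has to be decided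
   exactly, while an inequality between computable reals is not decidable. Hence the decision is
   taken on rounded data, with a threshold that exceeds the rounding error. Using [G] instead of
   exponential sums serves the same end: its Fourier coefficients are positive and of order [1/h^2],
   so one nonnegative quadratic expression controls all frequencies without any trigonometric value.
   The exponent 4 meets two demands. Among [N] slopes that are [K] apart, the inverse distances to a
   fixed one sum to [O(N^(1/2))]; this gives the mean energy and makes the selected proportion
   [O(N^(-1/2)) = O(M^(-2))], which is summable. Moreover [(M+1)^4 / M^4] tends to 1, so the counts
   at fourth powers control the counts at every [N]. There is a separate test for each [eps], and
   randomness is applied once per accuracy. Constants depending on [K] and on the size of [u_1'] are
   built into the programs as fixed numbers. *)
Scheme eval_code_mut := Minimality for eval_code Sort Prop
  with eval_codes_mut := Minimality for eval_codes Sort Prop.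
Combined Scheme eval_code_codes_ind from eval_code_mut, eval_codes_mut.

Lemma size_eval_codes o gs v w : eval_codes o gs v w -> size w = size gs.
Proof. by elim: gs w => [|g gs IH] w H; inversion H => //=; rewrite IH. Qed.

Lemma eval_codes_rcons o gs g v w y :
  eval_codes o gs v w -> eval_code o g v y ->
  eval_codes o (rcons gs g) v (rcons w y).
Proof.
elim: gs w => [|g0 gs IH] w H Hg; inversion H; subst => /=.
  exact: evals_cons Hg (evals_nil _ _).
by apply: evals_cons => //; apply: IH.
Qed.

(* The oracle, constantly [e], becomes an extra last argument; the arity [L] is
   tracked because that argument has to be told apart from absent ones. *)
Fixpoint const_oracle (L : nat) (c : Defs.code) : Defs.code :=
  match c with
  | Zero => Zero
  | Succ => Succ
  | Proj i => if (i < L)%N then Proj i else Zero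
  | Oracle => Proj L
  | Comp f gs => Comp (const_oracle (size gs) f)
                      (rcons (map (const_oracle L) gs) (Proj L))
  | Prec f g => Prec (const_oracle L.-1 f) (const_oracle L.+1 g)
  | Mu f => Mu (const_oracle L.+1 f)
  end.

Lemma eval_const_oracle e :
  (forall c v y, eval_code (fun=> e) c v y ->
     eval_code0 (const_oracle (size v) c) (rcons v e) y) /\
  (forall gs v w, eval_codes (fun=> e) gs v w ->
     eval_codes (fun=> 0%N) (map (const_oracle (size v)) gs) (rcons v e) w).
Proof.
apply: (@eval_code_codes_ind (fun=> e)
  (fun c v y => eval_code0 (const_oracle (size v) c) (rcons v e) y)
  (fun gs v w =>
     eval_codes (fun=> 0%N) (map (const_oracle (size v)) gs) (rcons v e) w)).
- by move=> v; exact: eval_Zero.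
- by move=> x v; exact: eval_Succ.
- move=> i v /=; case: ltnP => Hi.
    have := eval_Proj (fun=> 0%N) i (rcons v e); by rewrite nth_rcons Hi.
  rewrite nth_default //; exact: eval_Zero.
- move=> x v /=; have := eval_Proj (fun=> 0%N) (size v).+1 (rcons (x :: v) e).
  by rewrite nth_rcons /= ltnn eqxx.
- move=> f gs v w y Hgs IHgs _ IHf /=.
  apply: (@eval_Comp _ _ _ _ (rcons w e)).
    apply: eval_codes_rcons => //.
    have := eval_Proj (fun=> 0%N) (size v) (rcons v e).
    by rewrite nth_rcons ltnn eqxx.
  by rewrite -(size_eval_codes Hgs).
- by move=> f g v y _ IH /=; apply: eval_Prec0.
- by move=> f g n v z y _ IHz _ IHy /=; apply: eval_PrecS IHz IHy.
- move=> f v m z _ IHz _ IH0 /=; exact: (@eval_Mu _ _ _ _ z).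
- by move=> v; exact: evals_nil.
- by move=> g gs v y w _ IHg _ IHgs /=; apply: evals_cons.
Qed.

(** * Closure properties of total computable functions of fixed arity *)

Definition comp_fun (n : nat) (f : seq nat -> nat) : Prop :=
  exists c, forall v, size v = n -> eval_code0 c v (f v).

Lemma comp_ext n f g : comp_fun n f -> f =1 g -> comp_fun n g.
Proof. by case=> c H E; exists c => v /H; rewrite E. Qed.

Lemma comp_proj n i : comp_fun n (fun v => nth 0 v i).
Proof. by exists (Proj i) => v _; exact: eval_Proj. Qed.

Lemma comp_zero n : comp_fun n (fun=> 0).
Proof. by exists Zero => v _; exact: eval_Zero. Qed.

Lemma comp_comp n (F : seq nat -> nat) (fs : seq (seq nat -> nat)) :
  comp_fun (size fs) F -> foldr (fun f => and (comp_fun n f)) True fs ->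
  comp_fun n (fun v => F [seq f v | f <- fs]).
Proof.
case=> cF HF Hfs.
have [cs Hcs] : exists cs, forall v, size v = n ->
    eval_codes (fun=> 0) cs v [seq f v | f <- fs].
  elim: fs Hfs {HF} => [_|f fs IH /= [[c Hc] /IH[cs Hcs]]].
    by exists [::] => v _; exact: evals_nil.
  by exists (c :: cs) => v Hv; apply: evals_cons; [exact: Hc|exact: Hcs].
exists (Comp cF cs) => v Hv; apply: eval_Comp (Hcs v Hv) _.
by apply: HF; rewrite size_map.
Qed.

Lemma comp_app1 n (F : nat -> nat) f :
  comp_fun 1 (fun v => F (nth 0 v 0)) -> comp_fun n f ->
  comp_fun n (fun v => F (f v)).
Proof. by move=> HF Hf; apply: (@comp_comp n _ [:: f] HF). Qed.

Lemma comp_app2 n (F : nat -> nat -> nat) f g :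
  comp_fun 2 (fun v => F (nth 0 v 0) (nth 0 v 1)) ->
  comp_fun n f -> comp_fun n g -> comp_fun n (fun v => F (f v) (g v)).
Proof. by move=> HF Hf Hg; apply: (@comp_comp n _ [:: f; g] HF). Qed.

Lemma comp_app3 n (F : nat -> nat -> nat -> nat) f g h :
  comp_fun 3 (fun v => F (nth 0 v 0) (nth 0 v 1) (nth 0 v 2)) ->
  comp_fun n f -> comp_fun n g -> comp_fun n h ->
  comp_fun n (fun v => F (f v) (g v) (h v)).
Proof. by move=> HF Hf Hg Hh; apply: (@comp_comp n _ [:: f; g; h] HF). Qed.

Lemma comp_succ n f : comp_fun n f -> comp_fun n (fun v => (f v).+1).
Proof.
apply: (@comp_app1 n succn); exists Succ => -[|x v] //= _; exact: eval_Succ.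
Qed.

Lemma comp_const n k : comp_fun n (fun=> k).
Proof. by elim: k => [|k IH]; [exact: comp_zero|exact: comp_succ]. Qed.

Lemma comp_rec n f g :
  comp_fun n f -> comp_fun n.+2 g ->
  comp_fun n.+1 (fun w => nat_rect (fun=> nat) (f (behead w))
    (fun k z => g [:: k, z & behead w]) (nth 0 w 0)).
Proof.
case=> cf Hf [cg Hg]; exists (Prec cf cg) => -[|m v] //= [Hv].
elim: m => [|m IH] /=; first by apply: eval_Prec0; exact: Hf.
by apply: (eval_PrecS IH); apply: Hg; rewrite /= Hv.
Qed.

Lemma comp_add n f g : comp_fun n f -> comp_fun n g ->
  comp_fun n (fun v => f v + g v).
Proof.
apply: (@comp_app2 n addn).
have := comp_rec (comp_proj 1 0) (comp_succ (comp_proj 3 1)).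
move/comp_ext; apply => w /=; rewrite nth_behead.
by elim: (nth 0 w 0) => //= m ->; rewrite addSn.
Qed.

Lemma comp_mul n f g : comp_fun n f -> comp_fun n g ->
  comp_fun n (fun v => f v * g v).
Proof.
apply: (@comp_app2 n muln).
have := comp_rec (comp_const 1 0) (comp_add (comp_proj 3 2) (comp_proj 3 1)).
move/comp_ext; apply => w /=; rewrite nth_behead.
by elim: (nth 0 w 0) => //= m ->; rewrite mulSn.
Qed.

Lemma comp_exp n f g : comp_fun n f -> comp_fun n g ->
  comp_fun n (fun v => f v ^ g v).
Proof.
move=> Hf Hg; apply: (@comp_app2 n (fun x y => y ^ x)) Hg Hf.
have := comp_rec (comp_const 1 1) (comp_mul (comp_proj 3 2) (comp_proj 3 1)).
move/comp_ext; apply => w /=; rewrite nth_behead.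
by elim: (nth 0 w 0) => //= m ->; rewrite expnS.
Qed.

Lemma comp_pred n f : comp_fun n f -> comp_fun n (fun v => (f v).-1).
Proof.
apply: (@comp_app1 n predn).
have := comp_rec (comp_const 0 0) (comp_proj 2 0).
by move/comp_ext; apply => w /=; case: (nth 0 w 0).
Qed.

Lemma comp_sub n f g : comp_fun n f -> comp_fun n g ->
  comp_fun n (fun v => f v - g v).
Proof.
move=> Hf Hg; apply: (@comp_app2 n (fun x y => y - x)) Hg Hf.
have := comp_rec (comp_proj 1 0) (comp_pred (comp_proj 3 1)).
move/comp_ext; apply => w /=; rewrite nth_behead.
by elim: (nth 0 w 0) => [|m IH] /=; rewrite ?subn0 // IH subnS.
Qed.

Lemma comp_leq n f g : comp_fun n f -> comp_fun n g ->
  comp_fun n (fun v => f v <= g v : nat).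
Proof.
move=> Hf Hg; apply: comp_ext (comp_sub (comp_const n 1) (comp_sub Hf Hg)) _.
by move=> v; rewrite /leq; case: (f v - g v).
Qed.

Lemma comp_and n (f g : seq nat -> bool) :
  comp_fun n f -> comp_fun n g -> comp_fun n (fun v => f v && g v : nat).
Proof.
by move=> Hf Hg; apply: comp_ext (comp_mul Hf Hg) _ => v; rewrite -mulnb.
Qed.

Lemma comp_if n (b : seq nat -> bool) f g :
  comp_fun n b -> comp_fun n f -> comp_fun n g ->
  comp_fun n (fun v => if b v then f v else g v).
Proof.
move=> Hb Hf Hg; apply: comp_ext (comp_add (comp_mul Hb Hf)
  (comp_mul (comp_sub (comp_const n 1) Hb) Hg)) _ => v.
by case: (b v); rewrite ?mul1n ?mul0n ?addn0.
Qed.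

Lemma eval_projs o s v :
  eval_codes o [seq Proj (size s + i) | i <- iota 0 (size v)] (s ++ v) v.
Proof.
rewrite -[X in eval_codes _ _ _ X](mkseq_nth 0) /mkseq.
elim: (iota 0 _) => [|i l IH] /=; first exact: evals_nil.
apply: evals_cons => //.
by have := eval_Proj o (size s + i) (s ++ v); rewrite nth_cat ltnNge leq_addr /= addKn.
Qed.

Lemma comp_behead n f : comp_fun n f -> comp_fun n.+1 (fun w => f (behead w)).
Proof.
case=> c Hf; exists (Comp c [seq Proj (1 + i) | i <- iota 0 n]) => -[|x v] //= [Hv].
apply: eval_Comp (Hf v Hv); rewrite -Hv; exact: (eval_projs _ [:: x]).
Qed.

(** Bounded sums are the only loops used later: quotients, valuations, bounded quantifiers and the
    energy itself are all written as such sums. The summation index is put in front of the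
    arguments, whence the [behead]. *)
Lemma comp_sum n b (g : seq nat -> nat -> nat) :
  comp_fun n b -> comp_fun n.+1 (fun w => g (behead w) (nth 0 w 0)) ->
  comp_fun n (fun v => \sum_(i < b v) g v i).
Proof.
move=> [cb Hb] [cg Hg].
have Hstep : comp_fun n.+2
    (fun w => nth 0 w 1 + g (behead (behead w)) (nth 0 w 0)).
  apply: comp_add; first exact: comp_proj.
  exists (Comp cg (Proj 0 :: [seq Proj (2 + i) | i <- iota 0 n])).
  move=> -[|x [|y v]] //= [Hv].
  apply: (@eval_Comp _ _ _ _ (x :: v)); last by apply: (Hg (x :: v)); rewrite /= Hv.
  apply: evals_cons; first exact: (eval_Proj _ 0 _).
  rewrite -Hv; exact: (eval_projs _ [:: x; y]).
case: (comp_rec (comp_const n 0) Hstep) => cr Hr.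
exists (Comp cr (cb :: [seq Proj (0 + i) | i <- iota 0 n])) => v Hv.
apply: (@eval_Comp _ _ _ _ (b v :: v)).
  apply: evals_cons; first exact: Hb.
  rewrite -Hv; exact: (eval_projs _ [::]).
have := Hr (b v :: v); rewrite /= Hv => /(_ erefl).
by congr eval_code; elim: (b v) => [|m IH] /=; rewrite ?big_ord0 // big_ord_recr /= -IH.
Qed.

Lemma sum_ltn_nat m q : \sum_(j < m) (j < q : nat) = minn m q.
Proof.
elim: m => [|m IH]; first by rewrite big_ord0 min0n.
by rewrite big_ord_recr /= IH; case: (ltnP m q) => /=; lia.
Qed.

(** The quotient is the number of [j] with [(j + 1) * g <= f], and [j < f] is a sufficient range. *)
Lemma comp_div n f g : comp_fun n f -> comp_fun n g -> (forall v, 0 < g v) ->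
  comp_fun n (fun v => f v %/ g v).
Proof.
move=> Hf Hg g0.
have : comp_fun n (fun v => \sum_(j < f v) (j.+1 * g v <= f v : nat)).
  apply: (comp_sum Hf (g := fun v j => j.+1 * g v <= f v)).
  apply: comp_leq (comp_behead Hf); apply: comp_mul (comp_behead Hg).
  by apply: comp_succ; exact: comp_proj.
move/comp_ext; apply => v.
under eq_bigr do rewrite -leq_divRL //.
by rewrite sum_ltn_nat; apply/minn_idPr; exact: leq_div.
Qed.

Lemma comp_mod n f g : comp_fun n f -> comp_fun n g -> (forall v, 0 < g v) ->
  comp_fun n (fun v => f v %% g v).
Proof.
move=> Hf Hg g0.
apply: comp_ext (comp_sub Hf (comp_mul (comp_div Hf Hg g0) Hg)) _ => v.
by rewrite {1}(divn_eq (f v) (g v)) addKn.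
Qed.

(** The valuation of [m] counts the exponents [j + 1] with [p ^ (j + 1)] dividing [m]. *)
Lemma comp_logn n p f : prime p -> comp_fun n f ->
  comp_fun n (fun v => logn p (f v)).
Proof.
move=> pp Hf; apply: (comp_app1 (F := logn p)) Hf.
have : comp_fun 1 (fun v => \sum_(j < nth 0 v 0)
    (nth 0 v 0 %% p ^ j.+1 <= 0 : nat)).
  apply: (comp_sum (comp_proj 1 0) (g := fun v j => nth 0 v 0 %% p ^ j.+1 <= 0)).
  apply: comp_leq (comp_const _ _).
  apply: comp_mod; last by move=> v; rewrite expn_gt0 prime_gt0.
    exact: comp_behead (comp_proj 1 0).
  by apply: comp_exp; [exact: comp_const|apply: comp_succ; exact: comp_proj].
move/comp_ext; apply => v; case: (nth 0 v 0) => [|m]; first by rewrite big_ord0 logn0.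
under eq_bigr do rewrite leqn0 -[_ == 0]/(_ %| _) pfactor_dvdn //.
by rewrite sum_ltn_nat; apply/minn_idPr; exact/ltnW/ltn_logl.
Qed.

Local Open Scope ring_scope.

(** * Energy and uniform distribution *)

Section Diaphony.
Variable R : realType.
Implicit Types (x y : R) (z : nat -> R).

Lemma frac_part_itv y : 0 <= frac_part y < 1.
Proof.
by have := floor_itv y; rewrite /frac_part intrD => /andP[? ?]; apply/andP; lra.
Qed.

Lemma frac_part_def y (k : int) : 0 <= y - k%:~R < 1 -> frac_part y = y - k%:~R.
Proof.
move=> H; rewrite /frac_part (@floor_def _ y k) // intrD.
by move/andP: H => [? ?]; apply/andP; lra.
Qed.

Lemma frac_partDz y (k : int) : frac_part (y + k%:~R) = frac_part y.
Proof.
have /andP[h1 h2] := frac_part_itv y.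
rewrite (@frac_part_def (y + k%:~R) (Num.floor y + k)); last first.
  by move: h1 h2; rewrite /frac_part intrD => ? ?; apply/andP; lra.
by rewrite /frac_part intrD; ring.
Qed.

Definition bern2 y : R := frac_part y ^+ 2 - frac_part y + 6^-1.

Lemma bern2Dz y (k : int) : bern2 (y + k%:~R) = bern2 y.
Proof. by rewrite /bern2 frac_partDz. Qed.

(** One formula serves on both sides of 0 because the polynomial is symmetric under [y -> 1 - y].
    Differences of fractional parts thus need no reduction modulo 1. *)
Lemma bern2_small y : `|y| <= 1 -> bern2 y = y ^+ 2 - `|y| + 6^-1.
Proof.
rewrite /bern2 ler_norml => /andP[h1 h2].
have [y0|y0] := ltP y 0.
  by rewrite (@frac_part_def y (-1)) ?ltr0_norm //; [ring|apply/andP; lra].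
have [y1|y1] := ltP y 1.
  by rewrite (@frac_part_def y 0) ?ger0_norm //; [ring|apply/andP; lra].
have -> : y = 1 by lra.
by rewrite (@frac_part_def 1 1) ?normr1 //; [ring|apply/andP; lra].
Qed.

Lemma bern2_frac x y (d := frac_part x - frac_part y) :
  bern2 (x - y) = d ^+ 2 - `|d| + 6^-1.
Proof.
rewrite -bern2_small; last first.
  have /andP[? ?] := frac_part_itv x; have /andP[? ?] := frac_part_itv y.
  by rewrite ler_norml; apply/andP; rewrite /d; lra.
rewrite -(bern2Dz (x - y) (Num.floor y - Num.floor x)); congr bern2.
by rewrite /d /frac_part intrB; ring.
Qed.

(** On a period the derivative [2 y - 1] is at most 1 in absolute value, and the periodic function
    is continuous at the integers. *)
Lemma bern2_lip x y : `|bern2 x - bern2 y| <= `|x - y|.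
Proof.
wlog: x y / x <= y => [H|xy].
  by have [/H//|/ltW/H] := leP x y; rewrite distrC [`|y - x|]distrC.
have H (u v : R) : 0 <= u <= v -> v <= 1 -> `|bern2 u - bern2 v| <= v - u.
  move=> /andP[u0 uv] v1; have v0 := le_trans u0 uv.
  rewrite !bern2_small ?(ger0_norm u0) ?(ger0_norm v0) ?(le_trans uv) //.
  have -> : u ^+ 2 - u + 6^-1 - (v ^+ 2 - v + 6^-1) = (v - u) * (1 - u - v) by ring.
  rewrite normrM ger0_norm ?subr_ge0 // ler_piMr ?subr_ge0 //.
  by rewrite ler_norml; apply/andP; lra.
rewrite [`|x - y|]distrC (ger0_norm (_ : 0 <= y - x)) ?subr_ge0 //.
have /andP[hx0 hx1] := frac_part_itv x.
pose k := Num.floor x.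
have ex : x = frac_part x + k%:~R by rewrite subrK.
pose v := y - k%:~R.
have ey : y = v + k%:~R by rewrite subrK.
rewrite ex ey !bern2Dz; set u := frac_part x in ex hx0 hx1 *.
have uv : u <= v by move: xy; rewrite {1}ex {1}ey; lra.
have -> : v + k%:~R - (u + k%:~R) = v - u by ring.
have [v1|v1] := leP v 1; first by apply: H => //; rewrite hx0.
(* Beyond 2 the distance to [u < 1] exceeds 1, while [bern2] oscillates by at most [1/6 + 1/12]. *)
have [v2|v2] := leP v 2; last first.
  have ge u' : - 12^-1 <= bern2 u'.
    by rewrite /bern2; have := sqr_ge0 (frac_part u' - 2^-1); lra.
  have le u' : bern2 u' <= 6^-1.
    by rewrite /bern2; have /andP[? ?] := frac_part_itv u'; nra.
  have := ge u; have := ge v; have := le u; have := le v.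
  by rewrite ler_norml => *; apply/andP; lra.
have e0 : bern2 1 = bern2 0 by rewrite -(bern2Dz 0 1) add0r.
have -> : bern2 v = bern2 (v - 1) by rewrite -(bern2Dz (v - 1) 1) subrK.
have h1 : `|bern2 0 - bern2 (v - 1)| <= v - 1 - 0 by apply: H; lra.
have h2 : `|bern2 u - bern2 1| <= 1 - u by apply: H; lra.
rewrite e0 in h2.
by have := ler_normD (bern2 u - bern2 0) (bern2 0 - bern2 (v - 1)); rewrite addrA subrK; lra.
Qed.

(** * The energy of a sorted sample and its counting function *)

Lemma sum_sqr_diff z N :
  \sum_(i < N) \sum_(j < N) (z i - z j) ^+ 2 =
  2 * N%:R * (\sum_(i < N) z i ^+ 2) - 2 * (\sum_(i < N) z i) ^+ 2.
Proof.
have H i : \sum_(j < N) (z i - z j) ^+ 2 =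
    N%:R * z i ^+ 2 + (- 2 * \sum_(j < N) z j) * z i + \sum_(j < N) z j ^+ 2.
  have E (j : 'I_N) : true -> (z i - z j) ^+ 2 =
      z i ^+ 2 + (- 2 * z i) * z j + z j ^+ 2 by move=> _; ring.
  by rewrite (eq_bigr _ E) !big_split /= sumr_const card_ord -mulr_sumr -mulr_natl; ring.
under eq_bigr do rewrite H.
by rewrite !big_split /= sumr_const card_ord -!mulr_sumr -mulr_natl; ring.
Qed.

(** In sorted order [z i] is the larger member of [i] pairs and the smaller member of [N - 1 - i],
    so its net coefficient is [2 i + 1 - N]; every pair occurs twice. *)
Lemma sum_abs_diff z N :
  (forall i j, (i <= j < N)%N -> z i <= z j) ->
  \sum_(i < N) \sum_(j < N) `|z i - z j| =
  2 * \sum_(i < N) ((2 * i + 1)%:R - N%:R) * z i.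
Proof.
elim: N => [|N IH] zs; first by rewrite !big_ord0 mulr0.
rewrite big_ord_recr /=.
under eq_bigr do rewrite big_ord_recr /=.
rewrite big_split /= IH; last by move=> i j /andP[? ?]; apply: zs; lia.
rewrite !big_ord_recr /= subrr normr0 addr0.
have S c f : \sum_(i < N) (c - f i) = N%:R * c - \sum_(i < N) f i :> R.
  by rewrite sumrB sumr_const card_ord mulr_natl.
have -> : \sum_(i < N) `|z N - z i| = N%:R * z N - \sum_(i < N) z i.
  rewrite -S; apply: eq_bigr => i _.
  by rewrite ger0_norm // subr_ge0; apply: zs; have := ltn_ord i; lia.
have -> : \sum_(i < N) `|z i - z N| = N%:R * z N - \sum_(i < N) z i.
  rewrite -S; apply: eq_bigr => i _.
  by rewrite distrC ger0_norm // subr_ge0; apply: zs; have := ltn_ord i; lia.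
have -> : \sum_(i < N) ((2 * i + 1)%:R - N.+1%:R) * z i =
  \sum_(i < N) ((2 * i + 1)%:R - N%:R) * z i - \sum_(i < N) z i.
  by rewrite -sumrB; apply: eq_bigr => i _; rewrite -natr1; ring.
by rewrite natrD natrM -natr1; ring.
Qed.

Lemma sum_odd N : \sum_(i < N) (2 * i + 1)%:R = N%:R ^+ 2 :> R.
Proof.
elim: N => [|N IH]; first by rewrite big_ord0 expr0n.
by rewrite big_ord_recr /= IH natrD natrM -natr1; ring.
Qed.

Lemma sum_odd_sqr N :
  \sum_(i < N) (2 * i + 1)%:R ^+ 2 = N%:R * (4 * N%:R ^+ 2 - 1) / 3 :> R.
Proof.
elim: N => [|N IH]; first by rewrite big_ord0 !mul0r.
by rewrite big_ord_recr /= IH natrD natrM -natr1; field.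
Qed.

(* For a sorted sample the energy is, up to a constant, the variance of the
   deviations of the order statistics from the midpoints of [N] equal cells. *)
Lemma energy_sorted z N (w := fun i => z i - (2 * i + 1)%:R / (2 * N%:R)) :
  (0 < N)%N -> (forall i j, (i <= j < N)%N -> z i <= z j) ->
  \sum_(i < N) \sum_(j < N) ((z i - z j) ^+ 2 - `|z i - z j| + 6^-1) =
  2 * N%:R * (\sum_(i < N) (w i - (\sum_(i < N) w i) / N%:R) ^+ 2) + 6^-1.
Proof.
move=> N0 zs.
have N0' : N%:R != 0 :> R by rewrite pnatr_eq0 -lt0n.
set m := _ / N%:R.
have -> : \sum_(i < N) (w i - m) ^+ 2 = \sum_(i < N) w i ^+ 2 - N%:R * m ^+ 2.
  have E (i : 'I_N) : true -> (w i - m) ^+ 2 =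
      w i ^+ 2 + (- 2 * m) * w i + m ^+ 2 by move=> _; ring.
  rewrite (eq_bigr _ E) !big_split /= sumr_const card_ord -mulr_sumr -mulr_natl.
  have -> : \sum_(i < N) w i = N%:R * m by rewrite /m; field.
  by ring.
have -> : \sum_(i < N) w i ^+ 2 = \sum_(i < N) z i ^+ 2
   - (\sum_(i < N) (2 * i + 1)%:R * z i) / N%:R + (4 * N%:R ^+ 2 - 1) / (12 * N%:R).
  have E (i : 'I_N) : true -> w i ^+ 2 = z i ^+ 2 + (- N%:R^-1) * ((2 * i + 1)%:R * z i)
     + (4 * N%:R ^+ 2)^-1 * (2 * i + 1)%:R ^+ 2.
    by move=> _; rewrite /w; field.
  by rewrite (eq_bigr _ E) !big_split /= -!mulr_sumr sum_odd_sqr; field.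
have -> : m = ((\sum_(i < N) z i) - N%:R / 2) / N%:R.
  by rewrite /m sumrB -mulr_suml sum_odd; congr (_ / _); field.
have E : \sum_(i < N) \sum_(j < N) ((z i - z j) ^+ 2 - `|z i - z j| + 6^-1) =
   \sum_(i < N) \sum_(j < N) (z i - z j) ^+ 2 - \sum_(i < N) \sum_(j < N) `|z i - z j|
   + N%:R ^+ 2 / 6.
  under eq_bigr do rewrite !big_split /= sumrN sumr_const card_ord.
  rewrite !big_split /= sumrN sumr_const card_ord -mulrnA.
  by rewrite -[_ *+ (N * N)]mulr_natl natrM; ring.
rewrite E sum_sqr_diff sum_abs_diff //.
have -> : \sum_(i < N) ((2 * i + 1)%:R - N%:R) * z i =
   \sum_(i < N) (2 * i + 1)%:R * z i - N%:R * \sum_(i < N) z i.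
  by rewrite mulr_sumr -sumrB; apply: eq_bigr => i _; ring.
by field.
Qed.

(** Pigeonhole: values [K] apart lie in different cells of length [K]. It counts both midpoints at
    distance [1 / N] and slopes at distance [K]. *)
Lemma card_separated (T : finType) (A : {set T}) (y : T -> R) (K a l : R) :
  0 < K -> 0 <= l ->
  {in A &, forall i j, i != j -> K <= `|y i - y j|} ->
  {in A, forall i, a <= y i <= a + l} ->
  #|A|%:R <= l / K + 1.
Proof.
move=> K0 l0 sep bnd.
pose q := Num.truncn (l / K).
pose c i := Num.truncn ((y i - a) / K).
have c_ge i : i \in A -> 0 <= (y i - a) / K.
  by move=> /bnd/andP[h _]; rewrite divr_ge0 ?subr_ge0 // ltW.
have c_le i : i \in A -> (c i < q.+1)%N.
  move=> iA; rewrite ltnS; apply: le_truncn; rewrite ler_pM2r ?invr_gt0 //.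
  by have /andP[_] := bnd _ iA; lra.
have inj : {in A &, injective (fun i => inord (c i) : 'I_q.+1)}.
  move=> i j iA jA /(congr1 (@nat_of_ord q.+1)) /=; rewrite !inordK ?c_le // => e.
  apply/eqP/negP => /negP/(sep i j iA jA).
  have := truncn_itv (c_ge _ iA); have := truncn_itv (c_ge _ jA).
  rewrite -/(c i) -/(c j) e -natr1 => /andP[u1 u2] /andP[u3 u4].
  rewrite leNgt => /negP; apply.
  have -> : y i - y j = ((y i - a) / K - (y j - a) / K) * K by field; lra.
  rewrite normrM (gtr0_norm K0) gtr_pMl // ltr_norml; apply/andP; lra.
have -> : l / K + 1 = (l / K + 1 - q.+1%:R) + q.+1%:R by ring.
rewrite -(card_in_imset inj).
apply: (@le_trans _ _ q.+1%:R).
  by rewrite ler_nat -[X in (_ <= X)%N](card_ord q.+1) max_card.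
rewrite lerDr subr_ge0 -natr1 lerD2r.
by rewrite truncn_le divr_ge0 // ltW.
Qed.

Lemma sum_nat_card (T : finType) (P : pred T) :
  \sum_(i : T) (P i : nat) = #|[set i | P i]|.
Proof. by rewrite -big_mkcond sum1dep_card. Qed.

(** By Chebyshev's inequality all but [W / eta ^ 2] indices have a deviation within [eta] of the
    mean [m]. For the others the midpoint lies in an interval of length [b - a + 2 eta], which the
    unknown [m] merely translates. *)
Lemma count_sorted z N (a b eta : R) :
  (0 < N)%N -> 0 < eta -> a <= b -> (forall i j, (i <= j < N)%N -> z i <= z j) ->
  (\sum_(i < N) ((a <= z i < b)%R : nat))%:R <= N%:R * (b - a + 2 * eta) + 1 +
  (\sum_(i < N) \sum_(j < N) ((z i - z j) ^+ 2 - `|z i - z j| + 6^-1)) /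
  (2 * N%:R * eta ^+ 2).
Proof.
move=> N0 eta0 ab zs; have NR : 0 < N%:R :> R by rewrite ltr0n.
pose w i := z i - (2 * i + 1)%:R / (2 * N%:R).
pose m := (\sum_(i < N) w i) / N%:R; pose W := \sum_(i < N) (w i - m) ^+ 2.
rewrite (energy_sorted N0 zs) -/w -/m -/W.
rewrite sum_nat_card; set A := [set i | _].
pose B := [set i : 'I_N | eta < `|w i - m|].
have hB : #|B|%:R * eta ^+ 2 <= W.
  rewrite mulr_natl -sumr_const big_mkcond; apply: ler_sum => i _.
  rewrite inE; case: ifP => [h|_]; last exact: sqr_ge0.
  by rewrite -[leRHS]real_normK ?num_real //; apply: lerXn2r; rewrite ?nnegrE ?normr_ge0 // ltW.
have hA : #|A :\: B|%:R <= (b - a + 2 * eta) / N%:R^-1 + 1.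
  apply: (card_separated (y := fun i : 'I_N => (2 * i + 1)%:R / (2 * N%:R)) (a := a - m - eta)).
  - by rewrite invr_gt0.
  - lra.
  - move=> i j _ _ ij.
    have E k : (2 * k + 1)%:R = 2 * k%:R + 1 :> R by rewrite natrD natrM.
    have -> : (2 * i + 1)%:R / (2 * N%:R) - (2 * j + 1)%:R / (2 * N%:R)
       = (i%:R - j%:R) / N%:R :> R by rewrite !E; field; lra.
    have Nv : 0 <= N%:R^-1 :> R by rewrite invr_ge0 ltW.
    rewrite normrM (ger0_norm Nv); apply: (ler_peMl Nv).
    have {}ij : i != j :> nat by [].
    have [h|h] := leqP i j.
      by rewrite distrC -natrB // normr_nat ler1n; lia.
    by rewrite -natrB 1?ltnW // normr_nat ler1n; lia.
  - move=> i; rewrite !inE -leNgt ler_norml => /andP[/andP[h1 h2] /andP[h3 h4]].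
    by move: h1 h2; rewrite /w; set c := _ / _ => h1 h2; apply/andP; lra.
have : #|A|%:R <= #|A :\: B|%:R + #|B|%:R :> R.
  rewrite -natrD ler_nat -(cardsID B A) addnC leq_add2l subset_leq_card //.
  exact: subsetIr.
move=> /le_trans; apply; apply: lerD; first by rewrite invrK in hA; lra.
rewrite ler_pdivlMr; last by rewrite !mulr_gt0 ?exprn_gt0.
have := ler_pM2l NR (#|B|%:R * eta ^+ 2) W; rewrite hB; nra.
Qed.

(** Up to the factor [N^2 / (2 pi^2)] this is the squared diaphony: the sum over [h >= 1] of the
    squared Weyl sums divided by [pi^2 h^2]. *)
Definition energy (x : nat -> R) N : R := \sum_(i < N) \sum_(j < N) bern2 (x i - x j).

(** Energy and counts depend only on the multiset of fractional parts, so the sample may be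
    sorted. *)
Lemma energy_sort (x : nat -> R) N :
  exists z : nat -> R, [/\ forall i j, (i <= j < N)%N -> z i <= z j,
    energy x N = \sum_(i < N) \sum_(j < N) ((z i - z j) ^+ 2 - `|z i - z j| + 6^-1)
  & forall P : pred R,
    count (fun i => P (frac_part (x i))) (iota 0 N) = (\sum_(i < N) (P (z i) : nat))%N].
Proof.
pose s := mkseq (fun i => frac_part (x i)) N.
pose z := nth 0 (sort <=%R s).
have szs : size (sort <=%R s) = N by rewrite size_sort size_mkseq.
exists z; split.
- move=> i j /andP[ij jN].
  apply: (sorted_leq_nth (leT := <=%R) le_trans le_refl) => //.
  + exact: (sort_sorted (@le_total _ R)).
  + by rewrite inE szs (leq_ltn_trans ij).
  + by rewrite inE szs.
- have -> : energy x N = \sum_(a <- s) \sum_(b <- s) ((a - b) ^+ 2 - `|a - b| + 6^-1).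
    have I : iota 0 N = index_iota 0 N by rewrite /index_iota subn0.
    rewrite /energy big_map I big_mkord.
    apply: eq_bigr => i _; rewrite big_map I big_mkord.
    by apply: eq_bigr => j _; rewrite bern2_frac.
  have ps : perm_eq s (sort <=%R s) by rewrite perm_sym perm_sort.
  rewrite (perm_big _ ps) /= (big_nth 0) szs big_mkord; apply: eq_bigr => i _.
  by rewrite (perm_big _ ps) /= (big_nth 0) szs big_mkord.
- move=> P.
  have -> : count (fun i => P (frac_part (x i))) (iota 0 N) = count P s by rewrite count_map.
  have /permP -> : perm_eq s (sort <=%R s) by rewrite perm_sym perm_sort.
  by rewrite -sum1_count big_mkcond (big_nth 0) szs big_mkord.
Qed.

Lemma energy_ge0 (x : nat -> R) N : 0 <= energy x N.
Proof.
have [z [zs -> _]] := energy_sort x N; case: N zs => [|N] zs; first by rewrite big_ord0.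
rewrite energy_sorted //; apply: addr_ge0; last by lra.
by apply: mulr_ge0; [rewrite mulr_ge0|apply: sumr_ge0 => i _; exact: sqr_ge0].
Qed.

Lemma energy_count (x : nat -> R) N (a b eta : R) :
  (0 < N)%N -> 0 < eta -> a <= b ->
  (count (fun i => a <= frac_part (x i) < b) (iota 0 N))%:R <=
  N%:R * (b - a + 2 * eta) + 1 + energy x N / (2 * N%:R * eta ^+ 2).
Proof.
move=> N0 eta0 ab; have [z [zs -> cz]] := energy_sort x N.
by rewrite (cz (fun u => a <= u < b)); exact: count_sorted.
Qed.

(** * From small energy along fourth powers to uniform distribution *)

Lemma pow4_floor N : exists M, (M ^ 4 <= N < M.+1 ^ 4)%N.
Proof.
elim: N => [|N [M /andP[h1 h2]]]; first by exists 0%N.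
have [h|h] := ltnP N.+1 (M.+1 ^ 4); first by exists M; rewrite h (leq_trans h1).
by exists M.+1; rewrite h (leq_ltn_trans h2) // ltn_exp2r.
Qed.

Section Criterion.
Variable x : nat -> R.
Hypothesis energy_small : forall e, 0 < e -> exists M0, forall M, (M0 <= M)%N ->
  energy x (M ^ 4) <= e * (M ^ 4)%:R ^+ 2.

Let cnt (a b : R) N := count (fun i => a <= frac_part (x i) < b) (iota 0 N).

(** Counts increase with [N], so the count at [N] is at most the one at the next fourth power [L],
    where the energy is small. *)
Lemma cnt_upper a b e : a <= b -> b - a <= 1 -> 0 < e ->
  exists N0, forall N, (N0 <= N)%N -> (cnt a b N)%:R <= N%:R * (b - a + e).
Proof.
(* Five shares of [eta]: two for widening the interval, one for the energy, one for the additive 1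
   and one for replacing [N] by [L], which uses [eta <= 1] and [b - a <= 1]. *)
move=> ab ab1 e0; pose eta : R := Num.min (e / 5) 1.
have eta0 : 0 < eta by rewrite lt_min ltr01 andbT; lra.
have eta1 : eta <= 1 by rewrite ge_min lexx orbT.
have etae : 5 * eta <= e.
  by have : eta <= e / 5 by [rewrite ge_min lexx]; lra.
(* With this bound the term [energy / (2 L eta^2)] is at most [L eta]. *)
have [|M0 HM0] := @energy_small (2 * eta ^+ 3); first by rewrite mulr_gt0 ?exprn_gt0.
(* For [M >= 1] one has [(M+1)^4 <= M^4 (1 + 15/M)], and [M > 60 / eta] makes [15 / M] smaller than
   [eta / 4]. *)
pose m0 := maxn M0 (Num.truncn (60 / eta)).+1.
exists (maxn (m0 ^ 4) (Num.truncn (1 / eta)).+1) => N; rewrite geq_max => /andP[hN1 hN2].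
have [M /andP[MN NM]] := pow4_floor N.
have mM : (m0 <= M)%N.
  rewrite leqNgt; apply/negP => h; have : (M.+1 ^ 4 <= m0 ^ 4)%N by rewrite leq_exp2r.
  by lia.
move: mM; rewrite geq_max => /andP[mM1 mM2].
have M60 : 60 < eta * M%:R.
  have := truncnS_gt (60 / eta); rewrite ltr_pdivrMr // mulrC => /lt_le_trans; apply.
  by rewrite ler_pM2l // ler_nat.
have N1 : 1 < eta * N%:R.
  have := truncnS_gt (1 / eta); rewrite ltr_pdivrMr // mulrC => /lt_le_trans; apply.
  by rewrite ler_pM2l // ler_nat.
set L := (M.+1 ^ 4)%N.
have cL : (cnt a b N <= cnt a b L)%N.
  by rewrite /cnt -[L](subnKC (ltnW NM)) iotaD count_cat leq_addr.
have LR : 0 < L%:R :> R by rewrite ltr0n expn_gt0.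
have := @energy_count x L a b eta; rewrite expn_gt0 => /(_ isT eta0 ab).
have : energy x L / (2 * L%:R * eta ^+ 2) <= L%:R * eta.
  rewrite ler_pdivrMr ?mulr_gt0 ?exprn_gt0 //.
  have := HM0 M.+1; rewrite -/L => /(_ (leqW mM1)) /le_trans; apply.
  by rewrite le_eqVlt; apply/orP; left; apply/eqP; ring.
set E := _ / _ => hE; rewrite -/(cnt a b L) => hc.
have {cL} : (cnt a b N)%:R <= (cnt a b L)%:R :> R by rewrite ler_nat.
have M0' : 1 <= M%:R :> R by nra.
have hL : L%:R * M%:R <= N%:R * (M%:R + 15) :> R.
  apply: (@le_trans _ _ ((M ^ 4)%:R * (M%:R + 15))); last first.
    by apply: ler_wpM2r; [lra|rewrite ler_nat].
  rewrite /L !natrX -natr1; set t := M%:R; nra.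
have N0 : 0 < N%:R :> R by nra.
have hL2 : L%:R * eta * 4 <= eta * 4 * N%:R + eta * N%:R.
  nra.
have hL3 : L%:R <= N%:R + eta * N%:R / 4.
  nra.
move=> h; apply: (le_trans h); apply: (le_trans hc).
have : L%:R * (b - a) <= (N%:R + eta * N%:R / 4) * (b - a) by apply: ler_wpM2r; lra.
have : eta * N%:R / 4 * (b - a) <= eta * N%:R / 4 by apply: ler_piMr; nra.
nra.
Qed.

Lemma cnt_split a b N : 0 <= a -> a <= b -> b <= 1 ->
  (cnt 0 a N + cnt a b N + cnt b 1 N = N)%N.
Proof.
move=> a0 ab b1; rewrite /cnt -[RHS](size_iota 0 N).
elim: (iota 0 N) => //= i s <-.
have /andP[h0 h1] := frac_part_itv (x i).
rewrite h0 h1 andbT /=; case: (leP b) => [h|h]; case: (leP a) => [h'|h'] /=;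
  first [lia | exfalso; lra].
Qed.

(** Upper bounds suffice: the three intervals share out all [N] points, so upper bounds for the
    outer two, with error [e / 2] each, bound the middle one from below. *)
Lemma energy_ud a b : 0 <= a -> a <= b -> b <= 1 -> forall e, 0 < e ->
  exists N0, forall N, (N0 <= N)%N -> `|b - a - (cnt a b N)%:R / N%:R| <= e.
Proof.
move=> a0 ab b1 e e0.
have e20 : 0 < e / 2 by lra.
have [N1 H1] : exists N0, forall N, (N0 <= N)%N -> (cnt 0 a N)%:R <= N%:R * (a - 0 + e / 2).
  by apply: cnt_upper => //; lra.
have [N2 H2] : exists N0, forall N, (N0 <= N)%N -> (cnt a b N)%:R <= N%:R * (b - a + e / 2).
  by apply: cnt_upper => //; lra.
have [N3 H3] : exists N0, forall N, (N0 <= N)%N -> (cnt b 1 N)%:R <= N%:R * (1 - b + e / 2).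
  by apply: cnt_upper => //; lra.
exists (maxn 1 (maxn N1 (maxn N2 N3))) => N; rewrite !geq_max => /and4P[N0 h1 h2 h3].
have NR : 0 < N%:R :> R by rewrite ltr0n.
have := H1 N h1; have := H2 N h2; have := H3 N h3.
have : (cnt 0 a N + cnt a b N + cnt b 1 N)%:R = N%:R :> R by rewrite cnt_split.
rewrite !natrD => hs k3 k2 k1.
rewrite distrC ler_norml; apply/andP; split.
  by rewrite lerBrDr ler_pdivlMr //; nra.
by rewrite lerBlDr ler_pdivrMr //; nra.
Qed.

End Criterion.

End Diaphony.

(** * Mean values of the energy *)

Section Correlation.
Variable R : realType.
Implicit Types (x y : R).

Definition bern3 y : R :=
  frac_part y ^+ 3 / 3 - frac_part y ^+ 2 / 2 + frac_part y / 6.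

Lemma bern3Dz y (k : int) : bern3 (y + k%:~R) = bern3 y.
Proof. by rewrite /bern3 frac_partDz. Qed.

Lemma bern3_small y : 0 <= y <= 1 -> bern3 y = y ^+ 3 / 3 - y ^+ 2 / 2 + y / 6.
Proof.
move=> /andP[y0]; rewrite /bern3 le_eqVlt => /orP[/eqP ->|y1].
  by rewrite (@frac_part_def _ 1 1) ?expr1n //; [field|apply/andP; lra].
by rewrite (@frac_part_def _ y 0) ?subr0 //; apply/andP; lra.
Qed.

Lemma bern3_bound y : `|bern3 y| <= 24^-1.
Proof.
have /andP[h0 h1] := frac_part_itv y; rewrite /bern3; set f := frac_part y in h0 h1 *.
have -> : f ^+ 3 / 3 - f ^+ 2 / 2 + f / 6 = f * (1 - f) * ((1 - 2 * f) / 6) by field.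
have a0 : 0 <= f * (1 - f) by apply: mulr_ge0; lra.
have a1 : f * (1 - f) <= 4^-1 by have := sqr_ge0 (f - 2^-1); lra.
have a2 : `|(1 - 2 * f) / 6| <= 6^-1 by rewrite ler_norml; apply/andP; lra.
rewrite normrM (ger0_norm a0) (_ : 24^-1 = 4^-1 * 6^-1); last by field.
exact: ler_pM.
Qed.

Lemma bern2_bound y : `|bern2 y| <= 6^-1.
Proof.
have /andP[h0 h1] := frac_part_itv y; rewrite /bern2 ler_norml; apply/andP; split; last nra.
by have := sqr_ge0 (frac_part y - 2^-1); lra.
Qed.

(** [bern2] is the derivative of [bern3] and is 1-Lipschitz. Inside a period the constant is [1/2];
    across an integer two such estimates are joined there; over distances of at least 1 boundedness
    is enough. *)
Lemma bern3_taylor x y : `|bern3 y - bern3 x - bern2 x * (y - x)| <= (y - x) ^+ 2.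
Proof.
have H (u v : R) : 0 <= u <= 1 -> 0 <= v <= 1 ->
    `|bern3 v - bern3 u - bern2 u * (v - u)| <= (v - u) ^+ 2 / 2.
  move=> hu hv; rewrite !bern3_small // bern2_small; last first.
    by rewrite ger0_norm; case/andP: hu.
  move: hu hv => /andP[u0 u1] /andP[v0 v1]; rewrite (ger0_norm u0).
  have -> : v ^+ 3 / 3 - v ^+ 2 / 2 + v / 6 - (u ^+ 3 / 3 - u ^+ 2 / 2 + u / 6)
    - (u ^+ 2 - u + 6^-1) * (v - u) = (v - u) ^+ 2 * (2 * u / 3 + v / 3 - 2^-1) by field.
  rewrite normrM ger0_norm ?sqr_ge0 // ler_wpM2l ?sqr_ge0 // ler_norml; apply/andP; lra.
(* Changing the slope from [bern2 c] to [bern2 u] costs at most [(v - c) (c - u)], which completes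
   the two half squares to [(v - u)^2 / 2]. *)
have C (u v c : R) :
    `|bern3 v - bern3 c - bern2 c * (v - c)| <= (v - c) ^+ 2 / 2 ->
    `|bern3 c - bern3 u - bern2 u * (c - u)| <= (c - u) ^+ 2 / 2 ->
    0 <= (v - c) * (c - u) -> `|bern3 v - bern3 u - bern2 u * (v - u)| <= (v - u) ^+ 2.
  move=> h1 h2 h3; have h4 := bern2_lip c u.
  have h5 : `|(bern2 c - bern2 u) * (v - c)| <= (v - c) * (c - u).
    by rewrite normrM -(ger0_norm h3) normrM mulrC ler_wpM2l.
  have -> : bern3 v - bern3 u - bern2 u * (v - u) =
    (bern3 v - bern3 c - bern2 c * (v - c)) + (bern3 c - bern3 u - bern2 u * (c - u))
    + (bern2 c - bern2 u) * (v - c) by ring.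
  apply: (le_trans (ler_normD _ _)); have := ler_normD (bern3 v - bern3 c - bern2 c * (v - c))
    (bern3 c - bern3 u - bern2 u * (c - u)).
  have := sqr_ge0 (v - u); move: h1 h2 h5; lra.
have /andP[u0 u1] := frac_part_itv x.
set u := frac_part x in u0 u1.
set v := y - (Num.floor x)%:~R.
have -> : x = u + (Num.floor x)%:~R by rewrite subrK.
have -> : y = v + (Num.floor x)%:~R by rewrite subrK.
rewrite !bern3Dz bern2Dz.
have -> : v + (Num.floor x)%:~R - (u + (Num.floor x)%:~R) = v - u by ring.
(* Here [1/24 + 1/24 + |v - u| / 6] is already below the square. *)
have far : 1 <= `|v - u| -> `|bern3 v - bern3 u - bern2 u * (v - u)| <= (v - u) ^+ 2.
  move=> h; have b1 := bern3_bound v; have b2 := bern3_bound u; have b3 := bern2_bound u.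
  have b4 : `|bern2 u * (v - u)| <= 6^-1 * `|v - u| by rewrite normrM ler_wpM2r.
  have := ler_normB (bern3 v - bern3 u) (bern2 u * (v - u)).
  have := ler_normB (bern3 v) (bern3 u).
  rewrite -(real_normK (num_real (v - u))).
  nra.
have P3 : bern3 1 = bern3 0 by rewrite -(bern3Dz 0 1) add0r.
have P2 : bern2 (1 : R) = bern2 0 by rewrite -(bern2Dz 0 1) add0r.
have [v0|v0] := leP 0 v; last first.
  have [v1|v1] := leP (-1) v; last by apply: far; rewrite ltr0_norm; lra.
  apply: (C u v 0); last by nra.
    have := H 1 (v + 1); rewrite P3 P2 (bern3Dz v 1) addrK subr0.
    by apply; apply/andP; lra.
  by apply: H; apply/andP; lra.
have [v1|v1] := leP v 1.
  apply: le_trans (H _ _ _ _) _; [by apply/andP; lra|by apply/andP; lra|].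
  by have := sqr_ge0 (v - u); lra.
have [v2|v2] := leP v 2; last by apply: far; rewrite gtr0_norm; lra.
apply: (C u v 1); last by nra.
  have := H 0 (v - 1); rewrite -P3 -P2 -(bern3Dz (v - 1) 1) subrK subr0.
  by apply; apply/andP; lra.
by apply: H; apply/andP; lra.
Qed.

Lemma abel_sum (w F : nat -> R) n :
  \sum_(i < n.+1) w i * (F i.+1 - F i) =
  w n * F n.+1 - w 0%N * F 0%N - \sum_(i < n) (w i.+1 - w i) * F i.+1.
Proof.
elim: n => [|n IH]; first by rewrite big_ord_recr !big_ord0 /=; ring.
by rewrite big_ord_recr IH [in RHS]big_ord_recr /=; ring.
Qed.

(** After Abel summation the boundary terms contribute [2 B W], and the total variation of a
    monotone [w] bounded by [W] contributes at most another [2 B W]. *)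
Lemma abel_bound (w F : nat -> R) n (W B : R) :
  (forall i j, (i <= j < n)%N -> w i <= w j) \/
  (forall i j, (i <= j < n)%N -> w j <= w i) ->
  (forall i, (i < n)%N -> `|w i| <= W) -> (forall i, `|F i| <= B) -> 0 <= W ->
  `|\sum_(i < n) w i * (F i.+1 - F i)| <= 4 * B * W.
Proof.
wlog: w / (forall i j, (i <= j < n)%N -> w i <= w j) => [H|mono _].
  case=> [mono|mono]; first by apply: H => //; left.
  move=> hW hF W0; rewrite -normrN -sumrN.
  under eq_bigr do rewrite -mulNr.
  apply: (H (fun i => - w i)) => //; last by move=> i ?; rewrite normrN; apply: hW.
    by move=> i j h; rewrite lerN2; apply: mono.
  by left => i j h; rewrite lerN2; apply: mono.
move=> hW hF W0; have B0 : 0 <= B := le_trans (normr_ge0 _) (hF 0%N).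
case: n mono hW => [|n] mono hW; first by rewrite big_ord0 normr0 !mulr_ge0.
rewrite abel_sum.
have S : `|\sum_(i < n) (w i.+1 - w i) * F i.+1| <= (w n - w 0%N) * B.
  have -> : w n - w 0%N = \sum_(i < n) (w i.+1 - w i).
    by rewrite -(big_mkord xpredT (fun i => w i.+1 - w i)) telescope_sumr.
  apply: le_trans (ler_norm_sum _ _ _) _; rewrite mulr_suml; apply: ler_sum => i _.
  rewrite normrM ger0_norm ?subr_ge0; last by apply: mono; have := ltn_ord i; lia.
  by apply: ler_wpM2l => //; rewrite subr_ge0; apply: mono; have := ltn_ord i; lia.
have b (k l : nat) : (k < n.+1)%N -> `|w k * F l| <= W * B.
  by move=> kn; rewrite normrM ler_pM // hW.
have b1 := b n n.+1 (ltnSn _); have b2 := b 0%N 0%N (ltn0Sn _).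
have b3 : (w n - w 0%N) * B <= 2 * W * B.
  apply: ler_wpM2r => //; have := hW n (ltnSn _); have := hW 0%N (ltn0Sn _).
  by rewrite !ler_norml => /andP[? ?] /andP[? ?]; lra.
have := ler_normB (w n * F n.+1 - w 0%N * F 0%N) (\sum_(i < n) (w i.+1 - w i) * F i.+1).
have := ler_normB (w n * F n.+1) (w 0%N * F 0%N).
lra.
Qed.

(* [w i] is the inverse slope over the i-th grid cell: [bern2 (y i) / D] is, up to a
   quadratic error, [w i] times the increment of the bounded primitive [bern3]. *)
Lemma bern2_mean (y : nat -> R) (D : nat) (W L : R)
    (w := fun i => (D%:R * (y i.+1 - y i))^-1) :
  (0 < D)%N ->
  (forall i j, (i <= j < D)%N -> w i <= w j) \/
  (forall i j, (i <= j < D)%N -> w j <= w i) ->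
  (forall i, (i < D)%N -> w i != 0) ->
  (forall i, (i < D)%N -> `|w i| <= W) ->
  (forall i, (i < D)%N -> `|y i.+1 - y i| <= L / D%:R) ->
  `|\sum_(i < D) bern2 (y i)| <= D%:R * (W / 6 + L / D%:R).
Proof.
move=> D0 mono w0 hW hL.
have DR : 0 < D%:R :> R by rewrite ltr0n.
have W0 : 0 <= W by apply: le_trans (hW 0%N D0).
have E (i : 'I_D) : true -> bern2 (y i) = D%:R * (w i * (bern3 (y i.+1) - bern3 (y i)))
   - D%:R * (w i * (bern3 (y i.+1) - bern3 (y i) - bern2 (y i) * (y i.+1 - y i))).
  (* Since the inverse of 0 is 0, [w i != 0] says that the increment of [y] does not vanish. *)
  have : w i != 0 by exact: w0.
  by rewrite /w invr_eq0 mulf_eq0 negb_or => /andP[_ h] _; field; rewrite h gt_eqF.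
rewrite (eq_bigr _ E) sumrB -!mulr_sumr -mulrBr normrM (ger0_norm (ltW DR)).
rewrite ler_pM2l //; apply: (le_trans (ler_normB _ _)); apply: lerD.
  have -> : W / 6 = 4 * 24^-1 * W by field.
  apply: (abel_bound (F := fun i => bern3 (y i))) => // i; exact: bern3_bound.
apply: (le_trans (ler_norm_sum _ _ _)).
have -> : L / D%:R = \sum_(i < D) (L / D%:R / D%:R).
  by rewrite sumr_const card_ord -mulr_natl; field; rewrite gt_eqF.
apply: ler_sum => i _; rewrite normrM.
apply: le_trans (ler_wpM2l _ (bern3_taylor _ _)) _ => //.
(* In absolute value, [w i] times the squared increment is the increment over [D]: the possibly
   small slope cancels, and the [D] errors add up to at most [L / D]. *)
have := w0 i (ltn_ord i); rewrite /w invr_eq0 mulf_eq0 negb_or => /andP[_ h].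
have hn : 0 < `|y i.+1 - y i| by rewrite normr_gt0.
rewrite -(real_normK (num_real (y i.+1 - y i))) normfV normrM (ger0_norm (ltW DR)).
set t := `|y i.+1 - y i| in hn *.
have -> : (D%:R * t)^-1 * t ^+ 2 = t / D%:R by field; rewrite !gt_eqF.
by rewrite ler_pM2r ?invr_gt0 //; exact: hL.
Qed.

End Correlation.

Local Open Scope classical_set_scope.
Local Open Scope ring_scope.

(** * Calculus with one-sided derivatives on the unit interval *)

Section Derivatives.
Variable R : realType.
Implicit Types (f g : R -> R) (t s : R).

Lemma derivable01_near f t (e : R) : derivable01 f t -> 0 < e ->
  exists2 d, 0 < d & forall s, s \in `[0, 1] -> s != t -> `|s - t| < d ->
    `|deriv01 f t - diff_quot f t s| <= e.
Proof.
move=> Hf e0.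
have /cvgrPdist_le /(_ e e0) : diff_quot f t @ within `[0, 1] t^' --> deriv01 f t by [].
rewrite /within /dnbhs /= nearE => /nbhs_ballP [d d0 Hd].
exists d => // s s01 st sd; apply: (Hd s) => //.
by rewrite /ball /= distrC.
Qed.

(** Near a point the difference quotient is bounded by the size of the derivative plus 1, so the
    increment is of the order of [s - t']. *)
Lemma derivable01_cvg f : (forall s, s \in `[0, 1]%R -> derivable01 f s) ->
  {within `[0, 1], continuous f}.
Proof.
move=> Hf; apply/subspace_continuousP => t' t01.
have {}Hf := Hf t' t01.
apply/cvgrPdist_le => e e0; have [d d0 Hd] := derivable01_near Hf ltr01.
rewrite /within /= nearE; apply/nbhs_ballP.
pose c := `|deriv01 f t'| + 1; have c0 : 0 < c by rewrite ltr_wpDl.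
exists (Num.min d (e / c)); first by rewrite /= lt_min d0 divr_gt0.
move=> s /=; rewrite /ball /= lt_min distrC => /andP[sd se] s01.
have [->|st] := eqVneq s t'; first by rewrite subrr normr0 ltW.
have h := Hd s s01 st sd.
have st0 : s - t' != 0 by rewrite subr_eq0.
have -> : f t' - f s = - (diff_quot f t' s * (s - t')) by rewrite /diff_quot divfK // opprB.
rewrite normrN normrM; have hq : `|diff_quot f t' s| <= c.
  by have := ler_distD (deriv01 f t') 0 (diff_quot f t' s); rewrite !sub0r !normrN /c; lra.
apply: (@le_trans _ _ (c * `|s - t'|)); first by rewrite ler_wpM2r.
by move: se; rewrite ltr_pdivlMr // mulrC => /ltW.
Qed.

Lemma is_derive_deriv01 f t : 0 < t < 1 -> derivable01 f t ->
  is_derive t (1 : R) f (deriv01 f t).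
Proof.
move=> /andP[t0 t1] Hf.
have H : (h^-1 *: ((f \o shift t) (h *: (1 : R)) - f t)) @[h --> (0 : R)^'] --> deriv01 f t.
  apply/cvgrPdist_le => e e0; have [d d0 Hd] := derivable01_near Hf e0.
  rewrite /dnbhs /within /= nearE; apply/nbhs_ballP.
  exists (Num.min d (Num.min t (1 - t))); first by rewrite /= !lt_min d0 t0 subr_gt0.
  move=> h /=; rewrite /ball /= sub0r normrN !lt_min => /andP[hd /andP[ht ht']] h0.
  rewrite /shift /= [h *: 1]mulr1.
  have := Hd (h + t); rewrite /diff_quot addrK mulrC; apply => //.
    rewrite in_itv /=; move: ht ht'; rewrite !ltr_norml => /andP[? ?] /andP[? ?].
    by apply/andP; lra.
  by apply: contra h0 => /eqP ?; apply/eqP; lra.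
apply: DeriveDef; first by apply/cvg_ex; exists (deriv01 f t).
by rewrite /derive; apply: cvg_lim H; exact: norm_hausdorff.
Qed.

(** The derivative is one-sided only at 0 and 1, where the mean value theorem asks just for
    continuity. *)
Lemma MVT01 f g (a b : R) :
  (forall s, s \in `[0, 1] -> derivable01 f s) ->
  (forall s, s \in `[0, 1] -> derivable01 g s) ->
  0 <= a -> a < b -> b <= 1 ->
  exists2 c, a < c < b &
    (f b - g b) - (f a - g a) = (deriv01 f c - deriv01 g c) * (b - a).
Proof.
move=> Hf Hg a0 ab b1.
have [|c|c cab E] := @MVT _ (f - g) (fun c => deriv01 f c - deriv01 g c) a b ab.
- move=> c; rewrite in_itv /= => /andP[ac cb].
  have c01 : 0 < c < 1 by apply/andP; lra.
  have c01' : c \in `[0, 1] by rewrite in_itv /=; apply/andP; lra.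
  apply: is_deriveB.
    exact: is_derive_deriv01 c01 (Hf _ c01').
  exact: is_derive_deriv01 c01 (Hg _ c01').
- have sub : `[a, b] `<=` `[0, 1].
    by move=> s /=; rewrite !in_itv /= => /andP[? ?]; apply/andP; lra.
  apply: (continuous_subspaceW sub) => s.
  apply: continuousD _; first exact: (derivable01_cvg Hf).
  exact/continuousN/(derivable01_cvg Hg).
by exists c.
Qed.
End Derivatives.

(** * Averages of the energy of a Koksma sequence over a grid *)

Section MeanEnergy.
Variable R : realType.

Lemma norm_between (a b x : R) : a <= x <= b -> `|x| <= `|a| + `|b|.
Proof.
move=> /andP[ax xb]; have := ler_norm (- a); have := ler_norm b.
have := normr_ge0 a; have := normr_ge0 b.
by rewrite normrN ler_norml => *; apply/andP; lra.
Qed.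

Lemma inv_antitone (a b : R) : 0 < a * b -> a <= b -> b^-1 <= a^-1.
Proof.
move=> ab0 ab.
have a0 : a != 0 by apply: contraTneq ab0 => ->; rewrite mul0r ltxx.
have b0 : b != 0 by apply: contraTneq ab0 => ->; rewrite mulr0 ltxx.
rewrite -subr_ge0 (_ : a^-1 - b^-1 = (b - a) / (a * b)); last by field; rewrite a0 b0.
by rewrite divr_ge0 ?subr_ge0 // ltW.
Qed.

Lemma constant_sign01 (h : R -> R) : {within `[0, 1], continuous h} ->
  (forall t, t \in `[0, 1] -> h t != 0) ->
  forall s t, s \in `[0, 1] -> t \in `[0, 1] -> 0 < h s * h t.
Proof.
move=> ch h0 s t; wlog st : s t / s <= t => [H|] s01 t01.
  by have [/H|/ltW/H] := leP s t; [|rewrite mulrC]; apply.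
rewrite ltNge; apply/negP => neg.
have sub : `[s, t] `<=` `[0, 1].
  move: s01 t01; rewrite !in_itv /= => /andP[? ?] /andP[? ?] r /=.
  by rewrite !in_itv /= => /andP[? ?]; apply/andP; lra.
have [|c cst hc] := IVT (v := 0) st (continuous_subspaceW sub ch); last first.
  by have := h0 c (sub c cst); rewrite hc eqxx.
rewrite ge_min le_max.
have [hs|hs] := leP (h s) 0; have [ht|ht] := leP (h t) 0 => //=; try by lra.
- have hs' : h s < 0 by rewrite lt_neqAle hs h0.
  have ht' : h t < 0 by rewrite lt_neqAle ht h0.
  by have := nmulr_rgt0 (h t) hs'; rewrite ht' => h'; lra.
- by have := mulr_gt0 hs ht; lra.
Qed.

(** By the mean value theorem the inverse slope over cell [i] is [1 / h (c i)] with [c i]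
    increasing. As [h] is continuous without zeros it keeps its sign, so [1 / h] is monotone along
    with [h] and is bounded by its values at 0 and 1. *)
Lemma bern2_pair (f g : R -> R) (h := fun t => deriv01 f t - deriv01 g t)
    (L : R) (D : nat) :
  continuously_differentiable01 f -> continuously_differentiable01 g ->
  monotone01 h -> (forall t, t \in `[0, 1] -> h t != 0) ->
  (forall t, t \in `[0, 1] -> `|h t| <= L) -> (0 < D)%N ->
  `|\sum_(i < D) bern2 (f (i%:R / D%:R) - g (i%:R / D%:R))| <=
  D%:R * ((`|h 0|^-1 + `|h 1|^-1) / 6 + L / D%:R).
Proof.
move=> [df cf] [dg cg] mono h0 hL D0.
have DR : 0 < D%:R :> R by rewrite ltr0n.
have sgn : forall s t, s \in `[0, 1] -> t \in `[0, 1] -> 0 < h s * h t.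
  apply: constant_sign01 => // t; apply: continuousD _; first exact: cf.
  exact/continuousN/cg.
pose y i := f (i%:R / D%:R) - g (i%:R / D%:R).
have /choice[c Hc] : forall i, exists c, (i < D)%N ->
    i%:R / D%:R < c < i.+1%:R / D%:R /\ D%:R * (y i.+1 - y i) = h c.
  move=> i.
  have [iD|] := ltnP i D; last by exists 0.
  have [| | |c cab E] := MVT01 (a := i%:R / D%:R) (b := i.+1%:R / D%:R) df dg.
  - by rewrite divr_ge0.
  - by rewrite ltr_pM2r ?invr_gt0 // ltr_nat.
  - by rewrite ler_pdivrMr // mul1r ler_nat.
  - exists c => _; split=> //; rewrite /y E -natr1 -/(h c).
    by field; rewrite gt_eqF.
have c01 i : (i < D)%N -> c i \in `[0, 1].
  move=> iD; have [/andP[c1 c2] _] := Hc i iD; rewrite in_itv /=; apply/andP; split.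
    by apply: le_trans (ltW c1); rewrite divr_ge0.
  by apply: (le_trans (ltW c2)); rewrite ler_pdivrMr // mul1r ler_nat.
have cmono i j : (i <= j < D)%N -> c i <= c j.
  move=> /andP[]; rewrite leq_eqVlt => /orP[/eqP -> //|ij] jD.
  have [/andP[_ c2] _] := Hc i (ltn_trans ij jD); have [/andP[c3 _] _] := Hc j jD.
  apply: ltW; apply: (lt_trans c2); apply: le_lt_trans c3.
  by rewrite ler_pM2r ?invr_gt0 // ler_nat.
have ltD i j : (i <= j < D)%N -> (i < D)%N by move=> /andP[]; exact: leq_ltn_trans.
have ltD' i j : (i <= j < D)%N -> (j < D)%N by move=> /andP[].
have z01 : (0 : R) \in `[0, 1] by rewrite in_itv /= lexx ler01.
have o01 : (1 : R) \in `[0, 1] by rewrite in_itv /= lexx ler01.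
apply: (bern2_mean (y := y)) => //.
- case: mono => mono; [right|left] => i j hij;
    rewrite !(proj2 (Hc _ (ltD _ _ hij))) !(proj2 (Hc _ (ltD' _ _ hij))).
  + apply: inv_antitone; first by apply: sgn; apply: c01; [exact: ltD hij|exact: ltD' hij].
    by apply: mono; [apply: c01; exact: ltD hij|apply: c01; exact: ltD' hij|exact: cmono].
  + apply: inv_antitone; first by apply: sgn; apply: c01; [exact: ltD' hij|exact: ltD hij].
    by apply: mono; [apply: c01; exact: ltD' hij|apply: c01; exact: ltD hij|exact: cmono].
- by move=> i iD; rewrite (proj2 (Hc _ iD)) invr_eq0; apply: h0; exact: c01.
- move=> i iD; rewrite (proj2 (Hc _ iD)) -2!normfV.
  have := c01 i iD; move: (c i) => t t01.
  have /andP[t0 t1] : 0 <= t <= 1 by move: t01; rewrite in_itv.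
  case: mono => mono.
  + rewrite addrC; apply: norm_between; apply/andP; split; apply: inv_antitone;
      by [apply: sgn|apply: mono].
  + apply: norm_between; apply/andP; split; apply: inv_antitone;
      by [apply: sgn|apply: mono].
- move=> i iD; rewrite ler_pdivlMr // mulrC -[X in X * _](ger0_norm (ltW DR)) -normrM.
  by rewrite (proj2 (Hc _ iD)); apply: hL; exact: c01.
Qed.

(** Split at distance [Q K] from [y m]: at most [2 Q + 1] values are nearer, each contributing at
    most [1 / K], and the remaining ones, at most [Q^2], contribute at most [1 / (Q K)] each. *)
Lemma sum_inv_separated (Q : nat) (T : finType) (y : T -> R) (K : R) (m : T) :
  (0 < Q)%N -> 0 < K -> #|T| = (Q ^ 2)%N ->
  (forall i j, i != j -> K <= `|y i - y j|) ->
  \sum_(n | n != m) `|y m - y n|^-1 <= 4 * Q%:R / K.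
Proof.
move=> Q0 K0 cT sep; have QR : 1 <= Q%:R :> R by rewrite ler1n.
pose A := [set n : T | `|y m - y n| <= Q%:R * K]%SET.
have hA : #|A|%:R <= 2 * Q%:R * K / K + 1.
  apply: (card_separated (y := y) (a := y m - Q%:R * K)) => //.
  - by rewrite !mulr_ge0 // ltW.
  - by move=> i j _ _; exact: sep.
  - by move=> i; rewrite inE ler_norml => /andP[? ?]; apply/andP; lra.
rewrite mulfK ?gt_eqF // in hA.
have QK : 0 < Q%:R * K by rewrite mulr_gt0 // ltr0n.
apply: (@le_trans _ _ (\sum_(n : T) ((n \in A)%:R * K^-1 + (Q%:R * K)^-1))).
  rewrite big_mkcond; apply: ler_sum => n _; case: eqP => [->|/eqP nm] /=.
    by apply: addr_ge0; [apply: mulr_ge0 => //; rewrite invr_ge0 ltW|rewrite invr_ge0 ltW].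
  have mn : m != n by rewrite eq_sym.
  rewrite inE; case: (leP `|y m - y n| (Q%:R * K)) => h /=.
    rewrite mulr1n mul1r ler_wpDr ?invr_ge0 ?(ltW QK) // lef_pV2 ?posrE //; first exact: sep.
    exact: lt_le_trans (sep _ _ mn).
  rewrite mulr0n mul0r add0r lef_pV2 ?posrE //; first exact: ltW.
  exact: lt_trans h.
rewrite big_split /= -mulr_suml sumr_const cT -[_^-1 *+ _]mulr_natl.
have -> : \sum_(n : T) (n \in A)%:R = #|A|%:R :> R.
  by rewrite -natr_sum sum_nat_card; congr (_%:R); apply: eq_card => n; rewrite !inE.
have -> : (Q ^ 2)%:R * (Q%:R * K)^-1 = Q%:R / K.
  by rewrite natrX; field; rewrite !gt_eqF // ltr0n.
rewrite -mulrDl ler_pM2r ?invr_gt0 //; lra.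
Qed.

(** Per row [m], after division by [D]: the diagonal gives [1/6], the inverse slope differences at
    the two endpoints give at most [4 Q / K] each, divided by 6, and the grid errors give
    [Q^2 (2 L) / D <= Q]. There are [Q^2] rows. *)
Lemma mean_energy (u : nat -> R -> R) (K L : R) (Q D : nat) :
  K_koksma K u -> 0 < K -> (0 < Q)%N -> (0 < D)%N ->
  (forall n t, (1 <= n <= Q ^ 2)%N -> t \in `[0, 1] -> `|deriv01 (u n) t| <= L) ->
  2 * L * Q%:R <= D%:R ->
  \sum_(i < D) energy (fun n => u n.+1 (i%:R / D%:R)) (Q ^ 2) <=
  D%:R * (Q%:R ^+ 3 * (2 + 2 / K)).
Proof.
move=> [cd mono sep] K0 Q0 D0 hL hD.
have DR : 0 < D%:R :> R by rewrite ltr0n.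
have QR : 1 <= Q%:R :> R by rewrite ler1n.
set N := (Q ^ 2)%N.
have NR : N%:R = Q%:R ^+ 2 :> R by rewrite natrX.
have z01 : (0 : R) \in `[0, 1] by rewrite in_itv /= lexx ler01.
have o01 : (1 : R) \in `[0, 1] by rewrite in_itv /= lexx ler01.
rewrite /energy exchange_big /=.
have row (m : 'I_N) : \sum_(i < D) \sum_(n < N)
    bern2 (u m.+1 (i%:R / D%:R) - u n.+1 (i%:R / D%:R)) <=
    D%:R * (Q%:R * (2 + 2 / K)).
  rewrite exchange_big /= (bigD1 m) //=.
  have -> : \sum_(i < D) bern2 (u m.+1 (i%:R / D%:R) - u m.+1 (i%:R / D%:R)) = D%:R / 6.
    under eq_bigr do rewrite subrr bern2_small ?normr0 ?ler01 //.
    by rewrite expr0n /= subrr add0r sumr_const card_ord mulr_natl.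
  pose h n t := deriv01 (u m.+1) t - deriv01 (u n.+1) t.
  have pair (n : 'I_N) : n != m ->
      \sum_(i < D) bern2 (u m.+1 (i%:R / D%:R) - u n.+1 (i%:R / D%:R)) <=
      D%:R * ((`|h n 0|^-1 + `|h n 1|^-1) / 6 + (2 * L) / D%:R).
    move=> nm; apply: le_trans (ler_norm _) _; apply: bern2_pair => //.
    - exact: cd.
    - exact: cd.
    - exact: mono.
    - move=> t t01; rewrite -normr_gt0; apply: lt_le_trans K0 _; apply: sep => //.
      by move=> [/ord_inj e]; rewrite e eqxx in nm.
    - move=> t t01; apply: le_trans (ler_normB _ _) _; rewrite mulr_natl mulr2n.
      by apply: lerD; apply: hL => //; exact: ltn_ord.
  apply: (@le_trans _ _ (D%:R / 6 + \sum_(n < N | n != m)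
    D%:R * ((`|h n 0|^-1 + `|h n 1|^-1) / 6 + (2 * L) / D%:R))).
    by rewrite lerD2l; apply: ler_sum.
  rewrite -mulr_sumr big_split /= -mulr_suml big_split /=.
  have S t : t \in `[0, 1] -> \sum_(n < N | n != m) `|h n t|^-1 <= 4 * Q%:R / K.
    move=> t01; apply: (sum_inv_separated (y := fun n : 'I_N => deriv01 (u n.+1) t)) => //.
      by rewrite card_ord.
    by move=> i j ij; apply: sep => // -[/ord_inj e]; rewrite e eqxx in ij.
  have S0 := S _ z01; have S1 := S _ o01.
  have L0 : 0 <= L by apply: le_trans (hL 1%N 0 _ z01) => //; rewrite /= expn_gt0 Q0.
  have T : \sum_(n < N | n != m) (2 * L) / D%:R <= Q%:R.
    apply: (@le_trans _ _ (\sum_(n < N) (2 * L) / D%:R)).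
      by rewrite [leRHS](bigD1 m) //= lerDr divr_ge0 ?mulr_ge0 // ltW.
    rewrite sumr_const card_ord -[_ *+ N]mulr_natl NR mulrA ler_pdivrMr //.
    have -> : Q%:R ^+ 2 * (2 * L) = Q%:R * (2 * L * Q%:R) by ring.
    by rewrite ler_wpM2l.
  rewrite -mulrDr ler_pM2l //.
  have -> : Q%:R * (2 + 2 / K) = 2 * Q%:R + 2 * (Q%:R / K) by ring.
  have k0 : 0 <= Q%:R / K by rewrite divr_ge0 // ltW.
  rewrite -mulrA in S0; rewrite -mulrA in S1.
  move: QR S0 S1 T k0; move: (Q%:R / K) (Q%:R) => qK q.
  by move: (\sum_(i < N | _) _) (\sum_(i < N | _) _) (\sum_(i < N | _) _) => *; lra.
apply: le_trans (ler_sum _ (fun m _ => row m)) _.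
rewrite sumr_const card_ord -[_ *+ N]mulr_natl NR le_eqVlt; apply/orP; left; apply/eqP; ring.
Qed.
End MeanEnergy.

(** * Tests made of dyadic cells *)

Section GridMeasure.
Variable R : realType.
Local Notation mu := (@lebesgue_measure R).

Lemma lebesgue_measure_oo (a b : R) : a <= b -> mu `]a, b[ = (b - a)%:E.
Proof.
move=> ab; rewrite lebesgue_measure_itv /= lte_fin; case: ifP => //.
by move=> /negbT; rewrite -leNgt => ba; rewrite (@le_anti _ _ a b) ?ab // subrr.
Qed.

Lemma lebesgue_measure_cc (a b : R) : a <= b -> mu `[a, b] = (b - a)%:E.
Proof.
move=> ab; rewrite lebesgue_measure_itv /= lte_fin; case: ifP => //.
by move=> /negbT; rewrite -leNgt => ba; rewrite (@le_anti _ _ a b) ?ab // subrr.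
Qed.

Lemma lebesgue_bigsetU_le (A : nat -> set R) (c : nat -> R) n :
  (forall i, measurable (A i)) -> (forall i, (mu (A i) <= (c i)%:E)%E) ->
  (mu (\big[setU/set0]_(i < n) A i) <= (\sum_(i < n) c i)%:E)%E.
Proof.
move=> mA cA; apply: (le_trans (@Boole_inequality _ _ _ mu A n (fun i _ => mA i))).
by rewrite -sumEFin; apply: lee_sum => i _; exact: cA.
Qed.

Lemma lebesgue_bigcup_le (A : nat -> set R) (c : nat -> R) (C : R) :
  (forall i, measurable (A i)) -> (forall i, (mu (A i) <= (c i)%:E)%E) ->
  (forall n, \sum_(i < n) c i <= C) ->
  (mu (\bigcup_i A i) <= C%:E)%E.
Proof.
move=> mA cA cC.
have h := generalized_Boole_inequality mu mA (bigcupT_measurable _ mA).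

apply: (le_trans h).
apply: lime_le; first by apply: is_cvg_nneseries => n _ _; exact: measure_ge0.
apply: nearW => n; rewrite big_mkord; apply: (@le_trans _ _ (\sum_(i < n) (c i)%:E)%E).
  by apply: lee_sum => i _; exact: cA.
by rewrite sumEFin lee_fin.
Qed.

(** Disjoint open cells lie in [A] and the closed ones cover it; end points have measure zero. The
    grid starts at -1 because the widened cells below reach to the left of 0. *)
Lemma grid_measure (D J : nat) (P : pred nat) (A : set R)
    (c := fun j : nat => j%:R / D%:R - 1 : R) :
  (0 < D)%N -> measurable A ->
  (forall x, A x -> exists2 j, (j < J)%N && P j & c j <= x <= c j.+1) ->
  (forall j, (j < J)%N -> P j -> `]c j, c j.+1[ `<=` A) ->
  mu A = ((\sum_(j < J) (P j : nat))%:R / D%:R)%:E.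
Proof.
move=> D0 mA up low.
have DR : 0 < D%:R :> R by rewrite ltr0n.
have cc j : c j <= c j.+1 by rewrite /c lerD2r ler_pM2r ?invr_gt0 // ler_nat.
have cD j : c j.+1 - c j = D%:R^-1 by rewrite /c -natr1; field; rewrite gt_eqF.
have cmono i j : (i <= j)%N -> c i <= c j.
  by move=> ij; rewrite /c lerD2r ler_pM2r ?invr_gt0 // ler_nat.
pose w j : R := (P j)%:R / D%:R.
have E : ((\sum_(j < J) (P j : nat))%:R / D%:R)%:E = (\sum_(j < J) (w j)%:E)%E.
  by rewrite sumEFin natr_sum mulr_suml.
apply/eqP; rewrite eq_le; apply/andP; split.
- pose F j := if P j then `[c j, c j.+1]%classic else set0.
  have mF j : measurable (F j) by rewrite /F; case: ifP.
  have hF j : (mu (F j) <= (w j)%:E)%E.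
    rewrite /F /w; case: ifP => _; last by rewrite measure0 mul0r.
    by rewrite lebesgue_measure_cc // cD mul1r.
  rewrite E sumEFin.
  apply: le_trans (lebesgue_bigsetU_le J mF hF); apply: le_measure.
  + exact/mem_set.
  + by apply/mem_set; apply: bigsetU_measurable => i _; exact: mF.
  move=> x /up[j /andP[jJ Pj] cj]; rewrite -bigcup_mkord; exists j => //=.
  by rewrite /F Pj /= in_itv.
- pose G j := if P j then `]c j, c j.+1[%classic else set0.
  have mG j : measurable (G j) by rewrite /G; case: ifP.
  have hG j : mu (G j) = (w j)%:E.
    rewrite /G /w; case: ifP => _; last by rewrite measure0 mul0r.
    by rewrite lebesgue_measure_oo // cD mul1r.
  have tG : trivIset setT G.
    apply/trivIsetP => i j _ _ ij; rewrite -subset0 => x [].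
    wlog: i j ij / (i < j)%N => [H|lij].
      move: (ij); rewrite neq_ltn => /orP[/H|/H]; first exact.
      by move=> h ? ?; apply: h => //; rewrite eq_sym.
    rewrite /G; case: ifP => // _; case: ifP => // _ /=; rewrite !in_itv /=.
    by move=> /andP[_ h1] /andP[h2 _]; have := cmono _ _ lij; lra.
  rewrite E (_ : (\sum_(j < J) (w j)%:E)%E = (\sum_(j < J) mu (G j))%E); last first.
    by apply: eq_bigr => j _; rewrite hG.
  rewrite -measure_bigsetU //; apply: le_measure.
  + by apply/mem_set; apply: bigsetU_measurable => i _; exact: mG.
  + exact/mem_set.
  rewrite -bigcup_mkord => x [j jJ]; rewrite /G; case: ifP => // Pj; exact: low.
Qed.

End GridMeasure.

(** * Measures of unions of selected cells and of their finite parts *)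

Section DyadicTest.
Variables (R : realType) (d : nat -> nat) (sel : nat -> nat -> bool) (C : nat).
Hypothesis d_mono : forall a b, (a <= b)%N -> (d a <= d b)%N.
Hypothesis sel_few : forall M, (0 < M)%N ->
  (3 * M ^ 2 * \sum_(i < 2 ^ d M) sel M i <= C * 2 ^ d M)%N.
Local Notation mu := (@lebesgue_measure R).

(** Three mesh steps wide: an open neighbourhood of the closed grid cell from [i] to [i + 1], so
    that no grid point escapes. This is the factor 3 in [sel_few]. *)
Definition cell M (i : nat) : set R :=
  `](i%:R - 1) / (2 ^ d M)%:R, (i%:R + 2) / (2 ^ d M)%:R[%classic.
Definition layer M : set R :=
  [set x | exists i, [/\ (i < 2 ^ d M)%N, sel M i & cell M i x]].
Definition part a b : set R := [set x | exists2 M, (a <= M < b)%N & layer M x].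
Definition tail a : set R := [set x | exists2 M, (a <= M)%N & layer M x].

Lemma layerE M :
  layer M = \big[setU/set0]_(i < 2 ^ d M) if sel M i then cell M i else set0.
Proof.
rewrite -(bigcup_mkord _ (fun i => if sel M i then cell M i else set0)).
apply/seteqP; split => x.
  by move=> [i [iD si ci]]; exists i => //; rewrite si.
by move=> [i iD]; case: ifP => // si ci; exists i; split.
Qed.

Lemma measurable_layer M : measurable (layer M).
Proof.
by rewrite layerE; apply: bigsetU_measurable => i _; case: ifP => // _; exact: measurable_itv.
Qed.

Lemma tailE a : tail a = \bigcup_k layer (a + k).
Proof.
apply/seteqP; split => x; last by move=> [k _ h]; exists (a + k)%N => //; exact: leq_addr.
by move=> [M aM h]; exists (M - a)%N => //; rewrite subnKC.
Qed.

Lemma measurable_tail a : measurable (tail a).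
Proof. by rewrite tailE; apply: bigcupT_measurable => k; exact: measurable_layer. Qed.

Lemma partE a b :
  part a b = \big[setU/set0]_(M < b) if (a <= M)%N then layer M else set0.
Proof.
rewrite -(bigcup_mkord _ (fun M => if (a <= M)%N then layer M else set0)).
apply/seteqP; split => x.
  by move=> [M /andP[aM Mb] h]; exists M => //; rewrite aM.
by move=> [M Mb]; case: ifP => // aM h; exists M => //; rewrite aM.
Qed.

Lemma measurable_part a b : measurable (part a b).
Proof.
by rewrite partE; apply: bigsetU_measurable => i _; case: ifP => // _; exact: measurable_layer.
Qed.

Lemma layer_le M : (0 < M)%N -> (mu (layer M) <= (C%:R / M%:R ^+ 2)%:E)%E.
Proof.
move=> M0; rewrite layerE.
have D0 : 0 < (2 ^ d M)%:R :> R by rewrite ltr0n expn_gt0.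
apply: le_trans (lebesgue_bigsetU_le (A := fun i => if sel M i then cell M i else set0)
  (c := fun i => (sel M i)%:R * 3 / (2 ^ d M)%:R) (2 ^ d M) _ _) _.
- by move=> i; case: ifP => // _; exact: measurable_itv.
- move=> i; case: ifP => _; last by rewrite measure0 mul0r.
  rewrite lebesgue_measure_oo; last by rewrite ler_pM2r ?invr_gt0 //; lra.
  by rewrite -mulrBl mul1r lee_fin ler_pM2r ?invr_gt0 //; lra.
have MR : 0 < M%:R ^+ 2 :> R by rewrite exprn_gt0 // ltr0n.
rewrite -!mulr_suml -natr_sum lee_fin ler_pdivrMr // mulrAC ler_pdivlMr // mulrC.
idtac; rewrite mulrC -natrX -!natrM ler_nat -mulnA.
apply: leq_trans (sel_few M0); exact: eq_leq (mulnC _ _).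
Qed.

(** Telescoping: [1 / t^2 <= 2 (1/t - 1/(t+1))] for [t >= 1]. *)
Lemma tail_le a : (0 < a)%N -> (mu (tail a) <= (2 * C%:R / a%:R)%:E)%E.
Proof.
move=> a0; rewrite tailE.
have t0 k : 0 < (a + k)%:R :> R by rewrite ltr0n addn_gt0 a0.
apply: (lebesgue_bigcup_le (c := fun k => C%:R / (a + k)%:R ^+ 2)).
- by move=> k; exact: measurable_layer.
- by move=> k; apply: layer_le; rewrite addn_gt0 a0.
move=> n; apply: (@le_trans _ _ (2 * C%:R * (a%:R^-1 - (a + n)%:R^-1))); last first.
  by rewrite ler_wpM2l ?mulr_ge0 // gerBl invr_ge0 ltW.
elim: n => [|n IH]; first by rewrite big_ord0 addn0 subrr mulr0.
rewrite big_ord_recr /=; set t := (a + n)%:R in IH *.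
have t1 : 1 <= t by rewrite ler1n addn_gt0 a0.
have -> : (a + n.+1)%:R = t + 1 :> R by rewrite addnS -natr1.
have h : t ^- 2 <= 2 * (t^-1 - (t + 1)^-1).
  have -> : 2 * (t^-1 - (t + 1)^-1) = 2 / (t * (t + 1)) by field; apply/andP; lra.
  rewrite ler_pdivlMr; last by nra.
  rewrite mulrC ler_pdivrMr; nra.
have := ler_wpM2l (ler0n R C) h; lra.
Qed.

(* Cell [j] of the mesh [2 ^ - d b] that starts at the point [-1]. *)
Definition covered a b (j : nat) : bool :=
  (0 < \sum_(M < b) \sum_(i < 2 ^ d M)
     [&& (a <= M)%N, sel M i, (2 ^ d b + i * 2 ^ (d b - d M) <= j + 2 ^ (d b - d M))%N
      & (j < 2 ^ d b + (i + 2) * 2 ^ (d b - d M))%N])%N.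

Definition covered_count a b := (\sum_(j < 3 * 2 ^ d b) covered a b j)%N.

Lemma coveredP a b j : reflect (exists M i, [/\ (a <= M < b)%N, (i < 2 ^ d M)%N, sel M i,
    (2 ^ d b + i * 2 ^ (d b - d M) <= j + 2 ^ (d b - d M))%N
    & (j < 2 ^ d b + (i + 2) * 2 ^ (d b - d M))%N]) (covered a b j).
Proof.
rewrite /covered lt0n sum_nat_eq0 negb_forall; apply: (iffP existsP).
  move=> [M]; rewrite /= sum_nat_eq0 negb_forall => /existsP[i /=].
  rewrite eqb0 negbK => /and4P[h1 h2 h3 h4]; exists M, i; split => //.
  by rewrite h1 /=.
move=> [M [i [/andP[h1 h2] h3 h4 h5 h6]]]; exists (Ordinal h2).
rewrite /= sum_nat_eq0 negb_forall; apply/existsP; exists (Ordinal h3).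
by rewrite /= eqb0 negbK h1 h4 h5 h6.
Qed.

(** Since [d] is monotone, the mesh of stage [b] refines all earlier ones, so a finite part is a
    union of its cells up to mesh points. Its measure is an explicit rational. *)
Lemma part_measure a b :
  mu (part a b) = ((covered_count a b)%:R / (2 ^ d b)%:R)%:E.
Proof.
have pw M : (M <= b)%N -> (2 ^ d b)%:R = (2 ^ d M)%:R * (2 ^ (d b - d M))%:R :> R.
  by move=> Mb; rewrite -natrM -expnD subnKC // d_mono.
have p0 e : 0 < (2 ^ e)%:R :> R by rewrite ltr0n expn_gt0.
apply: grid_measure; [by rewrite expn_gt0|exact: measurable_part| |].
- move=> x [M aMb [i [iM si]]]; rewrite /cell /= in_itv /=.
  move=> /andP[]; rewrite ltr_pdivrMr // ltr_pdivlMr // => h1 h2.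
  have Mb : (M <= b)%N by move/andP: aMb => [_ /ltnW].
  have := pw M Mb; have := p0 (d M); have := p0 (d b - d M)%N.
  set A := (2 ^ d M)%:R in h1 h2 *; set r := (2 ^ (d b - d M))%:R => r0 A0 E.
  (* The position of [x] in fine cells counted from -1; its integer part is the index sought. *)
  pose y := (x + 1) * (2 ^ d b)%:R.
  have iA : i%:R + 1 <= A by rewrite /A natr1 ler_nat.
  have i0 : 0 <= i%:R :> R by [].
  have y1 : A * r + i%:R * r - r < y by rewrite /y E; nra.
  have y2 : y < A * r + (i%:R + 2) * r by rewrite /y E; nra.
  have y0 : 0 <= y.
    by apply: ltW; apply: le_lt_trans y1; nra.
  have /andP[j1 j2] := truncn_itv y0; set j := Num.truncn y in j1 j2.
  have c1 : (2 ^ d b + i * 2 ^ (d b - d M) <= j + 2 ^ (d b - d M))%N.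
    rewrite -ltnS -addSn -(ltr_nat R) !natrD natrM E -/r; lra.
  have c2 : (j < 2 ^ d b + (i + 2) * 2 ^ (d b - d M))%N.
    by rewrite -(ltr_nat R) natrD natrM natrD E -/r; lra.
  have c3 : (j < 3 * 2 ^ d b)%N.
    rewrite -(ltr_nat R) natrM E; apply: (le_lt_trans j1); apply: (lt_le_trans y2).
    have A1 : 1 <= A by rewrite /A ler1n expn_gt0.
    by nra.
  exists j; first by rewrite c3 /=; apply/coveredP; exists M, i; split.
  by apply/andP; split; rewrite ?lerBlDr ?lerBrDr ?ler_pdivrMr ?ler_pdivlMr // ltW.
- move=> j _ /coveredP[M [i [aMb iM si c1 c2]]] x /=; rewrite in_itv /=.
  move=> /andP[x1 x2]; exists M => //; exists i; split => //.
  have Mb : (M <= b)%N by move/andP: aMb => [_ /ltnW].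
  have := pw M Mb; have := p0 (d M); have := p0 (d b - d M)%N.
  have {}c2 : j.+1%:R <= (2 ^ d b + (i + 2) * 2 ^ (d b - d M))%:R :> R by rewrite ler_nat.
  have {}c1 : (2 ^ d b + i * 2 ^ (d b - d M))%:R <= (j + 2 ^ (d b - d M))%:R :> R.
    by rewrite ler_nat.
  rewrite !natrD natrM in c1; rewrite natrD natrM natrD in c2.
  rewrite /cell /= in_itv /= ltr_pdivrMr // ltr_pdivlMr //.
  move: c1 c2; set A := (2 ^ d M)%:R; set r := (2 ^ (d b - d M))%:R => c1 c2 r0 A0 E.
  rewrite E in x1 x2 c1 c2.
  have Ar : 0 < A * r by rewrite mulr_gt0.
  move: x1 x2; rewrite ltrBlDr ltr_pdivrMr // ltrBrDr ltr_pdivlMr // => x1 x2.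
  apply/andP; split; rewrite -(ltr_pM2r r0); nra.
Qed.

(** The rational measures of finite parts approximate the measure of a tail with the known error of
    a later tail: this makes the test Schnorr. *)
Lemma tail_approx a b : (mu (part a b) <= mu (tail a) <= mu (part a b) + mu (tail b))%E.
Proof.
apply/andP; split.
  apply: le_measure.
  - by apply: mem_set; exact: measurable_part.
  - by apply: mem_set; exact: measurable_tail.
  by move=> x [M /andP[aM _] h]; exists M.
apply: (@le_trans _ _ (mu (part a b `|` tail b))).
  apply: le_measure; [apply: mem_set; exact: measurable_tail| |].
    by apply: mem_set; apply: measurableU; [exact: measurable_part|exact: measurable_tail].
  move=> x [M aM h]; have [Mb|bM] := ltnP M b; [left|right]; exists M => //.
  by rewrite aM.
by apply: measureU2; [exact: measurable_part|exact: measurable_tail].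
Qed.

End DyadicTest.

Ltac comp_var := refine (comp_ext (comp_proj _ _) (fun w => _));
  rewrite ?nth_behead; reflexivity.
Ltac comp_step := first
  [ comp_var | apply: comp_const
  | apply: comp_and | apply: comp_leq
  | apply: comp_add | apply: comp_mul | apply: comp_exp | apply: comp_sub
  | apply: comp_succ | apply: comp_pred | (apply: comp_logn; first by []) ].
Ltac comp_auto := repeat comp_step.

Lemma decode_code (a b e : nat) :
  decode_rat (2 ^ a * 3 ^ b * 5 ^ e) = (a%:R - b%:R) / e.+1%:R.
Proof.
have p k : (0 < 2 ^ k)%N /\ (0 < 3 ^ k)%N /\ (0 < 5 ^ k)%N by rewrite !expn_gt0.
have [pa [_ _]] := p a; have [_ [pb _]] := p b; have [_ [_ pe]] := p e.
rewrite /decode_rat !lognM ?muln_gt0 ?pa ?pb //.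
rewrite !lognX (logn_prime 2) // (logn_prime 3) // (logn_prime 5) //=.
by rewrite (logn_prime 3) // (logn_prime 5) // (logn_prime 2) // !(muln0, muln1, addn0, add0n) /=.
Qed.

(** * A Schnorr test from a computable selection of cells *)

Section CellTest.
Variables (d : nat -> nat) (sel : nat -> nat -> bool).
Hypothesis comp_d : comp_fun 1 (fun v => d (nth 0%N v 0)).
Hypothesis comp_sel : comp_fun 2 (fun v => sel (nth 0%N v 0) (nth 0%N v 1) : nat).

Let Hd n f : comp_fun n f -> comp_fun n (fun v => d (f v)).
Proof. exact: comp_app1. Qed.

Let Hs n f g : comp_fun n f -> comp_fun n g ->
  comp_fun n (fun v => sel (f v) (g v) : nat).
Proof. exact: (@comp_app2 n (fun M i => sel M i : nat)). Qed.

Ltac comp_user := repeat first [comp_step | apply: Hs | apply: Hd].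

Lemma comp_covered :
  comp_fun 3 (fun v => covered d sel (nth 0%N v 0) (nth 0%N v 1) (nth 0%N v 2) : nat).
Proof.
apply: comp_leq; first exact: comp_const.
apply: (@comp_sum _ (fun v => nth 0 v 1)%N (fun v M => \sum_(i < 2 ^ d M)
     [&& (nth 0 v 0 <= M)%N, sel M i,
         (2 ^ d (nth 0 v 1) + i * 2 ^ (d (nth 0 v 1) - d M) <=
            nth 0 v 2 + 2 ^ (d (nth 0 v 1) - d M))%N
      & (nth 0 v 2 < 2 ^ d (nth 0 v 1) + (i + 2) * 2 ^ (d (nth 0 v 1) - d M))%N])%N).
  by comp_user.
apply: (@comp_sum _ (fun w => 2 ^ d (nth 0 w 0))%N (fun w i =>
     [&& (nth 0 (behead w) 0 <= nth 0 w 0)%N, sel (nth 0 w 0) i,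
         (2 ^ d (nth 0 (behead w) 1) + i * 2 ^ (d (nth 0 (behead w) 1) - d (nth 0 w 0)) <=
            nth 0 (behead w) 2 + 2 ^ (d (nth 0 (behead w) 1) - d (nth 0 w 0)))%N
      & (nth 0 (behead w) 2 < 2 ^ d (nth 0 (behead w) 1) +
           (i + 2) * 2 ^ (d (nth 0 (behead w) 1) - d (nth 0 w 0)))%N] : nat)).
  by comp_user.
by comp_user.
Qed.

Lemma comp_covered_count :
  comp_fun 2 (fun v => covered_count d sel (nth 0%N v 0) (nth 0%N v 1)).
Proof.
apply: (@comp_sum _ (fun v => 3 * 2 ^ d (nth 0 v 1))%N
  (fun v j => covered d sel (nth 0%N v 0) (nth 0%N v 1) j : nat)).
  by comp_user.
apply: (comp_app3 (F := fun a b j => covered d sel a b j : nat) comp_covered);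
  by comp_user.
Qed.

Variable C : nat.

(** Makes the bound [2 C / level n] of [tail_le] at most [2 ^- n]; the [+ 1] keeps the level
    positive when [C = 0]. *)
Definition level n := ((2 * C + 1) * 2 ^ n)%N.

(** The index [k] encodes a pair: the exponent of 2 is the number of layers past [level n], the
    exponent of 3 is the cell number. Every pair occurs. *)
Definition is_cell n k := (logn 3 k < 2 ^ d (level n + logn 2 k))%N
  && sel (level n + logn 2 k) (logn 3 k).

(** The exponents of 2, 3 and 5 are the positive and negative parts of the numerator and the
    denominator minus 1, so this codes [(i - 1) / 2 ^ d M], or else 3, where the extra interval
    begins. *)
Definition left_code n k : nat :=
  if is_cell n k
  then (2 ^ logn 3 k * 3 ^ 1 * 5 ^ (2 ^ d (level n + logn 2 k)).-1)%N
  else (2 ^ 3 * 3 ^ 0 * 5 ^ 0)%N.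

Definition right_code n k : nat :=
  if is_cell n k
  then (2 ^ (logn 3 k + 2) * 3 ^ 0 * 5 ^ (2 ^ d (level n + logn 2 k)).-1)%N
  else (2 ^ (3 * 2 ^ n + 1) * 3 ^ 0 * 5 ^ (2 ^ n).-1)%N.

(** With [c] the count and [D] the denominator, this is [c / D + 2 ^- n] as one fraction, the
    summand [2 ^- n] being the length of the extra interval. Stopping at [level k] loses a tail of
    measure at most [2 ^- k], the precision required. *)
Definition measure_code n k : nat :=
  (2 ^ (covered_count d sel (level n) (level k) * 2 ^ n + 2 ^ d (level k)) * 3 ^ 0
   * 5 ^ (2 ^ d (level k) * 2 ^ n).-1)%N.

Let Hl n f : comp_fun n f -> comp_fun n (fun v => level (f v)).
Proof. by move=> Hf; rewrite /level; comp_auto. Qed.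

Let Hc : comp_fun 2 (fun v => is_cell (nth 0%N v 0) (nth 0%N v 1) : nat).
Proof. by rewrite /is_cell; repeat first [comp_step | apply: Hs | apply: Hd | apply: Hl]. Qed.

Let computable_code (f : nat -> nat -> nat) :
  comp_fun 2 (fun v => f (nth 0%N v 0) (nth 0%N v 1)) ->
  computable_rat_seq2 (fun n k => decode_rat (f n k)).
Proof.
move=> [c Hf]; exists c => n k; exists (f n k) => //.
exact: (Hf [:: n; k]).
Qed.

Lemma computable_left : computable_rat_seq2 (fun n k => decode_rat (left_code n k)).
Proof.
apply: computable_code; apply: (comp_if Hc).
  by repeat first [comp_step | apply: Hd | apply: Hl].
exact: comp_const.
Qed.

Lemma computable_right : computable_rat_seq2 (fun n k => decode_rat (right_code n k)).
Proof.
apply: computable_code; apply: (comp_if Hc).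
  by repeat first [comp_step | apply: Hd | apply: Hl].
by repeat first [comp_step | apply: Hd | apply: Hl].
Qed.

Lemma computable_measure : computable_rat_seq2 (fun n k => decode_rat (measure_code n k)).
Proof.
apply: computable_code; rewrite /measure_code.
repeat first [comp_step | apply: Hd | apply: Hl
  | apply: (comp_app2 (F := covered_count d sel) comp_covered_count)].
Qed.

Variable R : realType.
Local Notation mu := (@lebesgue_measure R).
Hypothesis d_mono : forall a b, (a <= b)%N -> (d a <= d b)%N.
Hypothesis sel_few : forall M, (0 < M)%N ->
  (3 * M ^ 2 * \sum_(i < 2 ^ d M) sel M i <= C * 2 ^ d M)%N.

(* The extra interval supplies the terms of the enumeration that do not code a
   selected cell: all intervals of a test have to be nonempty. *)
Definition cell_test (n : nat) : set R :=
  `]3, (3 + 2 ^- n)[%classic `|` tail d sel (level n).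

Let pow0 e : 0 < (2 ^ e)%:R :> R.
Proof. by rewrite ltr0n expn_gt0. Qed.

Let ratr_code a b e :
  ratr (decode_rat (2 ^ a * 3 ^ b * 5 ^ e)) = (a%:R - b%:R) / e.+1%:R :> R.
Proof. by rewrite decode_code fmorph_div rmorphB /= !ratr_nat. Qed.

Lemma left_codeE n k : ratr (decode_rat (left_code n k)) =
  if is_cell n k then ((logn 3 k)%:R - 1) / (2 ^ d (level n + logn 2 k))%:R else 3 :> R.
Proof.
by rewrite /left_code; case: ifP => _; rewrite ratr_code ?subr0 ?divr1 ?prednK ?expn_gt0.
Qed.

Lemma right_codeE n k : ratr (decode_rat (right_code n k)) =
  if is_cell n k then ((logn 3 k)%:R + 2) / (2 ^ d (level n + logn 2 k))%:R
  else 3 + 2 ^- n :> R.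
Proof.
rewrite /right_code; case: ifP => _; rewrite ratr_code subr0 prednK ?expn_gt0 // natrD //.
by rewrite natrM natrX; field; rewrite expf_neq0.
Qed.

Lemma cell_testE n : cell_test n = \bigcup_k [set` `](ratr (decode_rat (left_code n k))),
  (ratr (decode_rat (right_code n k)))[ ].
Proof.
apply/seteqP; split => x.
- move=> [x3|[M nM [i [iM si ci]]]].
    (* This codes a cell number one past the last, hence the extra interval. *)
    pose k := (3 ^ (2 ^ d (level n)))%N.
    have k2 : logn 2 k = 0%N by rewrite lognX (logn_prime 2) //= muln0.
    have k3 : logn 3 k = (2 ^ d (level n))%N by rewrite lognX (logn_prime 3) //= muln1.
    by exists k => //; rewrite left_codeE right_codeE /is_cell k2 k3 addn0 ltnn.
  pose k := (2 ^ (M - level n) * 3 ^ i)%N.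
  have k2 : logn 2 k = (M - level n)%N.
    by rewrite lognM ?expn_gt0 // !lognX (logn_prime 2) // (logn_prime 2) //= muln0 addn0 muln1.
  have k3 : logn 3 k = i.
    by rewrite lognM ?expn_gt0 // !lognX (logn_prime 3) // (logn_prime 3) //= muln0 add0n muln1.
  exists k => //; rewrite left_codeE right_codeE /is_cell k2 k3 subnKC // iM si /=.
  exact: ci.
- move=> [k _]; rewrite left_codeE right_codeE; case: ifP => [/andP[h1 h2] h|_ h]; last by left.
  by right; exists (level n + logn 2 k)%N; [exact: leq_addr|exists (logn 3 k); split].
Qed.

Let level_gt0 n : (0 < level n)%N.
Proof. by rewrite muln_gt0 expn_gt0 addn1. Qed.

Let tail_small n : (mu (tail d sel (level n)) <= (2 ^- n)%:E)%E.
Proof.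
apply: le_trans (tail_le _ sel_few (level_gt0 n)) _; rewrite lee_fin.
rewrite ler_pdivrMr ?ltr0n // /level natrM natrX [leRHS]mulrC -mulrA mulfV ?expf_neq0 // mulr1.
by rewrite -natrM ler_nat leq_addr.
Qed.

(** Keeps the extra interval, which begins at 3, disjoint from the cells, so that the measures
    add. *)
Let tail_le2 a x : tail d sel a x -> x <= (2 : R).
Proof.
move=> [M _ [i [iD _]]]; rewrite /cell /= in_itv /= => /andP[_ /ltW h].
apply: (le_trans h); rewrite ler_pdivrMr // -natrD -natrM ler_nat.
have : (0 < 2 ^ d M)%N by rewrite expn_gt0.
by lia.
Qed.

Let tau n := fine (mu (tail d sel (level n))).

Let tauE n : mu (tail d sel (level n)) = (tau n)%:E.
Proof.
rewrite /tau fineK // ge0_fin_numE ?measure_ge0 //.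
by apply: le_lt_trans (tail_small n) _; exact: ltry.
Qed.

Lemma measure_cell_test n : mu (cell_test n) = (2 ^- n + tau n)%:E.
Proof.
have p : 0 <= 2 ^- n :> R by rewrite invr_ge0 exprn_ge0.
pose I : set R := `]3, (3 + 2 ^- n)[%classic.
have E : mu (cell_test n) = (mu I + mu (tail d sel (level n)))%E.
  apply: measureU; [exact: measurable_itv|exact: measurable_tail|].
  by rewrite -subset0 => x [] /=; rewrite in_itv /= => /andP[h _] /tail_le2; lra.
by rewrite E /I lebesgue_measure_oo ?lerDl // tauE -EFinD (addrC 3) addrK.
Qed.

Lemma measure_codeE n k :
  `|fine (mu (cell_test n)) - ratr (decode_rat (measure_code n k))| <= 2 ^- k :> R.
Proof.
rewrite measure_cell_test /= /measure_code ratr_code subr0 prednK ?muln_gt0 ?expn_gt0 //.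
rewrite natrD !natrM.
set c := (covered_count _ _ _ _)%:R; set D := (2 ^ d (level k))%:R.
have D0 : 0 < D by exact: pow0.
have -> : (c * (2 ^ n)%:R + D) / (D * (2 ^ n)%:R) = c / D + 2 ^- n.
  by rewrite natrX; field; rewrite expf_neq0 // gt_eqF.
have := tail_approx R d sel (level n) (level k).
rewrite part_measure // -/c -/D !tauE -EFinD !lee_fin => /andP[h1 h2].
have := tail_small k; rewrite tauE lee_fin => h3.
by rewrite ler_norml; apply/andP; lra.
Qed.

Lemma cell_test_schnorr : schnorr_test cell_test.
Proof.
have cm : computable_real_seq (fun n => fine (mu (cell_test n))).
  exists (fun n k => decode_rat (measure_code n k)); first exact: computable_measure.
  exact: measure_codeE.
split => //; split.
- exists (fun n k => decode_rat (left_code n k)), (fun n k => decode_rat (right_code n k)).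
  split; [exact: computable_left|exact: computable_right| |exact: cell_testE].
  move=> n k; rewrite -(ltr_rat R) left_codeE right_codeE; case: ifP => _.
    by rewrite ltr_pM2r ?invr_gt0 //; lra.
  by rewrite ltrDl invr_gt0 exprn_gt0.
- move=> n x [/= h|[M nM h]].
    left; move: h; rewrite /= !in_itv /= => /andP[-> h] /=; apply: (lt_le_trans h).
    by rewrite lerD2l lef_pV2 ?posrE ?exprn_gt0 // ler_eXn2l // ltr1n.
  right; exists M => //; apply: leq_trans nM.
  by rewrite /level leq_mul2l leq_exp2l // leqnSn orbT.
- exists (fun n => fine (mu (cell_test n))); split => //; last first.
    by move=> n; rewrite measure_cell_test.
  have -> : (fun n => fine (mu (cell_test n))) = (fun n => 2 ^- n + tau n).
    by apply/funext => n; rewrite measure_cell_test.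
  apply/cvgrPdist_le => e e0.
  have e20 : 0 < e / 2 by lra.
  apply: filterS (near_infty_natSinv_expn_lt (PosNum e20)) => n /=; rewrite mul1r => h.
  have t0 : 0 <= tau n by apply: fine_ge0; exact: measure_ge0.
  have := tail_small n; rewrite tauE lee_fin => t1.
  have p : 0 <= 2 ^- n :> R by rewrite invr_ge0 exprn_ge0.
  by rewrite sub0r normrN ger0_norm ?addr_ge0 //; lra.
Qed.

Lemma schnorr_avoids (x : R) : schnorr_random x ->
  exists M0, forall M, (M0 <= M)%N -> ~ layer d sel M x.
Proof.
move=> /(_ _ cell_test_schnorr) h.
have [n hn] : exists n, ~ cell_test n x by apply/existsNP.
by exists (level n) => M nM hM; apply: hn; right; exists M.
Qed.

End CellTest.

(** * The test of an effective Koksma sequence *)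

(** At a rational point the sequence that repeats its code is a valid oracle, and a constant oracle
    can be turned into an argument. The successor is there because the sequence starts at index
    1. *)
Lemma eval_rational (R : realType) (u : nat -> R -> R) (k m : nat) (f e : seq nat -> nat) :
  computable_fun_seq u -> comp_fun m f -> comp_fun m e ->
  (forall v, ratr (decode_rat (e v)) \in `[(0 : R), 1]) ->
  exists2 val : seq nat -> nat, comp_fun m val & forall v, size v = m ->
    `|u (f v).+1 (ratr (decode_rat (e v))) - ratr (decode_rat (val v))| <= 2 ^- k.
Proof.
move=> [c Hc] Hf He e01.
have [cf Hcf] : comp_fun m (fun v => (f v).+1) by exact: comp_succ.
have [ck Hck] := comp_const m k; have [ce Hce] := He.
have /choice[val Hval] : forall v, exists y, size v = m ->
    eval_code0 (Comp (const_oracle 2 c) [:: cf; ck; ce]) v y /\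
    `|u (f v).+1 (ratr (decode_rat (e v))) - ratr (decode_rat y)| <= 2 ^- k.
  move=> v; have [sv|sv] := eqVneq (size v) m; last by exists 0%N => /eqP; rewrite (negPf sv).
  have or : oracle_for (fun=> e v) (ratr (decode_rat (e v)) : R).
    by move=> j; rewrite subrr normr0 invr_ge0 exprn_ge0.
  have [y Hy Hu] := Hc (f v).+1 k isT _ (e01 v) _ or.
  exists y => _; split => //.
  apply: (@eval_Comp _ _ _ _ [:: (f v).+1; k; e v]); last first.
    exact: (proj1 (eval_const_oracle _) _ _ _ Hy).
  apply: evals_cons; first exact: Hcf.
  apply: evals_cons; first exact: Hck.
  apply: evals_cons; first exact: Hce.
  exact: evals_nil.
exists val; last by move=> v /Hval[].
by exists (Comp (const_oracle 2 c) [:: cf; ck; ce]) => v /Hval[].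
Qed.

Section KoksmaTest.
Variable R : realType.

(** Crude, but the bound is the code itself, so a program computing approximations also computes
    natural upper bounds. *)
Lemma decode_rat_le (m : nat) : `|ratr (decode_rat m)| <= m%:R :> R.
Proof.
have [->|m0] := posnP m.
  by rewrite /decode_rat !logn0 subrr mul0r rmorph0 normr0.
have l p : (logn p m <= m)%N by exact/ltnW/ltn_logl.
rewrite /decode_rat fmorph_div rmorphB /= !ratr_nat normrM normfV.
rewrite ler_pdivrMr ?normr_gt0 ?pnatr_eq0 // normr_nat.
have d1 : 1 <= (logn 5 m).+1%:R :> R by rewrite ler1n.
have : `|(logn 2 m)%:R - (logn 3 m)%:R| <= m%:R :> R.
  have := l 2%N; have := l 3%N; rewrite -!(ler_nat R) => h3 h2.
  have := ler0n R (logn 2 m); have := ler0n R (logn 3 m).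
  by rewrite ler_norml => *; apply/andP; lra.
by move=> /le_trans; apply; rewrite ler_peMr.
Qed.

Lemma bounded01 (f : R -> R) : {within `[0, 1], continuous f} ->
  exists B : nat, forall t, t \in `[0, 1] -> `|f t| <= B%:R.
Proof.
move=> cf; have [a _ ha] := EVT_max ler01 cf; have [b _ hb] := EVT_min ler01 cf.
exists (Num.truncn (`|f a| + `|f b|)).+1 => t t01.
apply: (@le_trans _ _ (`|f b| + `|f a|)); last by rewrite addrC ltW // truncnS_gt.
by apply: norm_between; rewrite ha ?hb.
Qed.

(* Rounding a coded rational to a multiple of [1 / P], modulo integers: since
   [(a - b) / (e + 1) + b = (a + b * e) / (e + 1)], no subtraction is needed. *)
Definition round_mod (P m : nat) : nat :=
  ((P * (logn 2 m + logn 3 m * logn 5 m)) %/ (logn 5 m).+1 %% P)%N.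

Lemma round_modP (P m : nat) : (0 < P)%N -> exists k : int,
  `|ratr (decode_rat m) - ((round_mod P m)%:R / P%:R + k%:~R)| <= P%:R^-1 :> R.
Proof.
move=> P0; rewrite /round_mod /decode_rat fmorph_div rmorphB /= !ratr_nat.
set a := logn 2 m; set b := logn 3 m; set e := logn 5 m.
set q := (_ %/ e.+1)%N; set z := (q %% P)%N.
exists ((q %/ P)%N%:Z - b%:Z).
have PR : 0 < P%:R :> R by rewrite ltr0n.
have eR : 0 < e.+1%:R :> R by rewrite ltr0n.
have hq1 : q%:R * e.+1%:R <= P%:R * (a%:R + b%:R * e%:R) :> R.
  by rewrite -!natrM -natrD -natrM ler_nat leq_trunc_div.
have hq2 : P%:R * (a%:R + b%:R * e%:R) < (q%:R + 1) * e.+1%:R :> R.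
  by rewrite natr1 -!natrM -natrD -!natrM ltr_nat ltn_ceil.
have hq : q%:R = (q %/ P)%:R * P%:R + z%:R :> R by rewrite -natrM -natrD -divn_eq.
have -> : (a%:R - b%:R) / e.+1%:R - (z%:R / P%:R + ((q %/ P)%:Z - b%:Z)%:~R) =
   ((P%:R * (a%:R + b%:R * e%:R)) / e.+1%:R - q%:R) / P%:R :> R.
  rewrite hq intrB -!pmulrn -natr1; field; rewrite natr1 !gt_eqF //.
rewrite normrM [`|P%:R^-1|]ger0_norm ?invr_ge0 // ler_piMl ?invr_ge0 //.
by rewrite ler_norml lerBrDr lerBlDr ler_pdivlMr // ler_pdivrMr //; apply/andP; nra.
Qed.

Lemma grid_values (u : nat -> R -> R) (k : nat) : computable_fun_seq u ->
  exists2 val : nat -> nat -> nat -> nat,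
    comp_fun 3 (fun v => val (nth 0 v 0) (nth 0 v 1) (nth 0 v 2))%N &
    forall n e i, (i <= 2 ^ e)%N ->
      `|u n.+1 (i%:R / (2 ^ e)%:R) - ratr (decode_rat (val n e i))| <= 2 ^- k.
Proof.
move=> hu.
(* Truncated subtraction yields the minimum of [i] and [2 ^ e], which keeps the point in the unit
   interval for all arguments. *)
pose ex (v : seq nat) : nat := (nth 0 v 2 - (nth 0 v 2 - 2 ^ nth 0 v 1))%N.
pose pt (v : seq nat) : nat := (2 ^ ex v * 3 ^ 0 * 5 ^ (2 ^ nth 0 v 1).-1)%N.
have ptE v : ratr (decode_rat (pt v)) = (ex v)%:R / (2 ^ nth 0 v 1)%N%:R :> R.
  by rewrite decode_code fmorph_div rmorphB /= !ratr_nat subr0 prednK // expn_gt0.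
have [| |v|val Hc Hv] := @eval_rational _ u k 3 (fun v => nth 0 v 0)%N pt hu.
- exact: comp_proj.
- by rewrite /pt /ex; comp_auto.
- rewrite ptE in_itv /= divr_ge0 //= ler_pdivrMr ?ltr0n ?expn_gt0 // mul1r ler_nat /ex; lia.
exists (fun n e i => val [:: n; e; i]).
  by case: Hc => c Hc; exists c => -[|n [|e [|i []]]] // sv; exact: Hc.
move=> n e i ie; have := Hv [:: n; e; i] erefl; rewrite ptE /ex /=.
by rewrite (_ : i - (i - 2 ^ e) = i)%N //; lia.
Qed.

(** * Selection of the grid points where the rounded energy is large *)

Section Test.
Variables (u : nat -> R -> R) (K : R) (p : nat).
Hypotheses (hK : K_koksma K u) (K0 : 0 < K).
Variables (B : nat) (der0 der1 : nat -> nat) (val : nat -> nat -> nat -> nat).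
Hypothesis hB : forall t, t \in `[0, 1] -> `|deriv01 (u 1%N) t| <= B%:R.
Hypothesis hder0 : forall n, `|deriv01 (u n.+1) 0| <= (der0 n)%:R + 1.
Hypothesis hder1 : forall n, `|deriv01 (u n.+1) 1| <= (der1 n)%:R + 1.
Hypothesis hval : forall n e i, (i <= 2 ^ e)%N ->
  `|u n.+1 (i%:R / (2 ^ e)%:R) - ratr (decode_rat (val n e i))| <= 2 ^- p.
Hypothesis comp_der0 : comp_fun 1 (fun v => der0 (nth 0 v 0))%N.
Hypothesis comp_der1 : comp_fun 1 (fun v => der1 (nth 0 v 0))%N.
Hypothesis comp_val :
  comp_fun 3 (fun v => val (nth 0 v 0) (nth 0 v 1) (nth 0 v 2))%N.

Local Notation P := (2 ^ p)%N.

(** A sum rather than a maximum: it dominates each term and grows with [N], so that [mesh] is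
    monotone. *)
Definition der_sum N := (\sum_(n < N) (der0 n + der1 n))%N.
(* [u_n' - u_1'] is monotone, hence bounded by its endpoint values; this makes the
   bound on [u_n'] computable from [u_n' 0] and [u_n' 1] alone. *)
Definition slope M := (3 * B + 2 + der_sum (M ^ 4))%N.
Definition mesh M := (der_sum (M ^ 4) + M ^ 4 + (3 * B + 4 + p))%N.

Definition sample M n i := round_mod P (val n (mesh M) i).
Definition dist_nat (a b : nat) := ((a - b) + (b - a))%N.

(* Integer form of [energy > 8 N^2 / P] for the rounded sample. *)
Definition selected M i : bool :=
  (\sum_(m < M ^ 4) \sum_(n < M ^ 4) 6 * P * dist_nat (sample M m i) (sample M n i)
     + 48 * P * (M ^ 4) ^ 2 <
   \sum_(m < M ^ 4) \sum_(n < M ^ 4)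
     (6 * dist_nat (sample M m i) (sample M n i) ^ 2 + P ^ 2))%N.

Lemma comp_mesh : comp_fun 1 (fun v => mesh (nth 0 v 0))%N.
Proof.
have H : comp_fun 1 (fun v => der_sum (nth 0 v 0 ^ 4))%N.
  apply: (@comp_sum _ (fun v => nth 0 v 0 ^ 4) (fun v n => der0 n + der1 n))%N.
    by comp_auto.
  by apply: comp_add; [apply: (comp_app1 comp_der0)|apply: (comp_app1 comp_der1)]; comp_auto.
by apply: comp_add; [apply: comp_add => //|]; comp_auto.
Qed.

Lemma comp_selected :
  comp_fun 2 (fun v => selected (nth 0 v 0) (nth 0 v 1) : nat)%N.
Proof.
have Hs : comp_fun 3 (fun v => sample (nth 0 v 0) (nth 0 v 1) (nth 0 v 2))%N.
  rewrite /sample; apply: (comp_app1 (F := round_mod P)).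
    rewrite /round_mod; apply: comp_mod; last by move=> _; rewrite expn_gt0.
      by apply: comp_div => //; comp_auto.
    exact: comp_const.
  apply: (comp_app3 comp_val); [comp_auto| |comp_auto].
  by apply: (comp_app1 comp_mesh); comp_auto.
have Hd : comp_fun 4 (fun w => dist_nat (sample (nth 0 w 0) (nth 0 w 1) (nth 0 w 2))
     (sample (nth 0 w 0) (nth 0 w 3) (nth 0 w 2)))%N.
  by apply: comp_add; apply: comp_sub; apply: (comp_app3 Hs); comp_auto.
have H (F : nat -> nat) : comp_fun 1 (fun v => F (nth 0 v 0))%N ->
    comp_fun 2 (fun v => \sum_(m < nth 0 v 0 ^ 4) \sum_(n < nth 0 v 0 ^ 4)
      F (dist_nat (sample (nth 0 v 0) m (nth 0 v 1)) (sample (nth 0 v 0) n (nth 0 v 1))))%N.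
  move=> HF.
  apply: (@comp_sum _ (fun v => nth 0 v 0 ^ 4)%N (fun v m => \sum_(n < nth 0 v 0 ^ 4)
      F (dist_nat (sample (nth 0 v 0) m (nth 0 v 1)) (sample (nth 0 v 0) n (nth 0 v 1))))%N).
    by comp_auto.
  apply: (@comp_sum _ (fun w => nth 0 (behead w) 0 ^ 4)%N (fun w n =>
      F (dist_nat (sample (nth 0 (behead w) 0) (nth 0 w 0) (nth 0 (behead w) 1))
                  (sample (nth 0 (behead w) 0) n (nth 0 (behead w) 1))))%N).
    by comp_auto.
  apply: (comp_app1 HF).
  have := @comp_comp 4 _ [:: (fun w => nth 0 w 2)%N; (fun w => nth 0 w 1)%N;
     (fun w => nth 0 w 3)%N; (fun w => nth 0 w 0)%N] Hd.
  have vars : foldr (fun f => and (comp_fun 4 f)) True [:: (fun w => nth 0 w 2)%N;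
      (fun w => nth 0 w 1)%N; (fun w => nth 0 w 3)%N; (fun w => nth 0 w 0)%N].
    by do !split; exact: comp_proj.
  by move=> /(_ vars) h; apply: comp_ext h _ => w /=; rewrite !nth_behead.
apply: comp_leq.
  apply: comp_succ; apply: comp_add; last by comp_auto.
  by apply: (H (fun x => 6 * P * x)%N); comp_auto.
by apply: (H (fun x => 6 * x ^ 2 + P ^ 2)%N); comp_auto.
Qed.



(** The constant [3 * B + 2]: at each endpoint the difference with [u_1'] costs [B] and an
    approximation error of 1, and adding [u_1' t] back costs another [B]. *)
Lemma slope_bound M n t : (n < M ^ 4)%N -> t \in `[0, 1] ->
  `|deriv01 (u n.+1) t| <= (slope M)%:R.
Proof.
move=> nN t01; have [_ mono _] := hK.
have z01 : (0 : R) \in `[0, 1] by rewrite in_itv /= lexx ler01.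
have o01 : (1 : R) \in `[0, 1] by rewrite in_itv /= lexx ler01.
have /andP[t0 t1] : 0 <= t <= 1 by move: t01; rewrite in_itv.
pose h t := deriv01 (u n.+1) t - deriv01 (u 1%N) t.
have ht : `|h t| <= `|h 0| + `|h 1|.
  case: (mono n.+1 1%N isT isT) => H.
    by apply: norm_between; apply/andP; split; apply: H.
  by rewrite addrC; apply: norm_between; apply/andP; split; apply: H.
have -> : deriv01 (u n.+1) t = h t + deriv01 (u 1%N) t by rewrite subrK.
have d : (der0 n + der1 n <= der_sum (M ^ 4))%N.
  by rewrite /der_sum (bigD1 (Ordinal nN)) //= leq_addr.
have : (3 * B + 2 + (der0 n + der1 n))%:R <= (slope M)%:R :> R.
  by rewrite ler_nat /slope; lia.
rewrite natrD (natrD _ (3 * B)) natrM natrD => /(le_trans _); apply.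
apply: le_trans (ler_normD _ _) _.
have e0 : `|h 0| <= (der0 n)%:R + 1 + B%:R.
  exact: le_trans (ler_normB _ _) (lerD (hder0 n) (hB z01)).
have e1 : `|h 1| <= (der1 n)%:R + 1 + B%:R.
  exact: le_trans (ler_normB _ _) (lerD (hder1 n) (hB o01)).
apply: le_trans (lerD (le_trans ht (lerD e0 e1)) (hB t01)) _.
by clear e0 e1 ht h; lra.
Qed.

Lemma mesh_mono a b : (a <= b)%N -> (mesh a <= mesh b)%N.
Proof.
move=> ab; have ab4 : (a ^ 4 <= b ^ 4)%N by rewrite leq_exp2r.
rewrite leq_add2r leq_add // /der_sum -(subnKC ab4) big_split_ord /=.
exact: leq_addr.
Qed.

(** As [x < 2 ^ x], summands of the exponent dominate the factors on the left. The bound makes the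
    grid fine enough for [mean_energy] and lets a move by one mesh step change [u_m - u_n] by at
    most [1 / P]. *)
Lemma mesh_large M : (2 * slope M * (M ^ 4 + 1) * P <= 2 ^ mesh M)%N.
Proof.
rewrite /mesh /slope; set S := der_sum _; set N := (M ^ 4)%N.
have hS : (S < 2 ^ S)%N by exact: ltn_expl.
have hN : (N < 2 ^ N)%N by exact: ltn_expl.
have hT : (3 * B < 2 ^ (3 * B))%N by exact: ltn_expl.
move: (3 * B)%N hT => T hT.
rewrite !expnD mulnA leq_mul2r expn_eq0 /=.
apply: (@leq_trans (S.+1 * N.+1 * (2 ^ T * 2 ^ 4))); last first.
  by apply: leq_mul => //; apply: leq_mul.
rewrite addn1 [leqRHS]mulnAC leq_mul2r /=; move: (2 ^ T)%N hT => c hT; nia.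
Qed.

Let grid M i : R := i%:R / (2 ^ mesh M)%:R.

Let rounded_energy M i : R := \sum_(m < M ^ 4) \sum_(n < M ^ 4)
  (let x := (dist_nat (sample M m i) (sample M n i))%:R / P%:R in x ^+ 2 - x + 6^-1).

Let PR : 0 < P%:R :> R.
Proof. by rewrite ltr0n expn_gt0. Qed.

Let sample_approx M n i : (i <= 2 ^ mesh M)%N ->
  exists k : int, `|u n.+1 (grid M i) - ((sample M n i)%:R / P%:R + k%:~R)| <= 2 / P%:R.
Proof.
move=> iD; have P0 : (0 < P)%N by rewrite expn_gt0.
have [k hk] := round_modP (val n (mesh M) i) P0.
exists k; apply: le_trans (ler_distD (ratr (decode_rat (val n (mesh M) i))) _ _) _.
have := hval n iD; rewrite -natrX /sample => h.
by have := lerD h hk; lra.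
Qed.

Let rounded_bern2 M i m n :
  let x := (dist_nat (sample M m i) (sample M n i))%:R / P%:R : R in
  bern2 ((sample M m i)%:R / P%:R - (sample M n i)%:R / P%:R : R) = x ^+ 2 - x + 6^-1.
Proof.
have lt k : (sample M k i < P)%N by rewrite ltn_mod expn_gt0.
move: (lt m) (lt n); set a := sample M m i; set b := sample M n i => aP bP x.
have e : `|a%:R / P%:R - b%:R / P%:R| = x.
  rewrite /x /dist_nat -mulrBl normrM [`|_^-1|]ger0_norm ?invr_ge0 ?(ltW PR) //; congr (_ * _).
  have [ab|ba] := leqP a b.
    by rewrite distrC -natrB // normr_nat (eqP ab).
  by rewrite -natrB 1?ltnW // normr_nat (eqP (ltnW ba : _ - _ == 0)%N) addn0.
have x1 : x <= 1.
  by rewrite /x ler_pdivrMr // mul1r ler_nat /dist_nat; lia.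
by rewrite bern2_small e // -(real_normK (num_real (_ - _))) e.
Qed.

(** Each value is known modulo 1 within [2 / P], half from evaluation and half from rounding. So
    each difference is off by at most [4 / P], and [bern2] is periodic and 1-Lipschitz. *)
Lemma sample_energy M i : (i <= 2 ^ mesh M)%N ->
  `|energy (fun n => u n.+1 (grid M i)) (M ^ 4) - rounded_energy M i| <=
  4 * (M ^ 4)%:R ^+ 2 / P%:R.
Proof.
move=> iD; rewrite /energy /rounded_energy -sumrB.
have -> : 4 * (M ^ 4)%:R ^+ 2 / P%:R = \sum_(m < M ^ 4) \sum_(n < M ^ 4) (4 / P%:R) :> R.
  by rewrite !sumr_const card_ord -mulrnA -[_ *+ (_ * _)]mulr_natl natrM; ring.
apply: le_trans (ler_norm_sum _ _ _) _; apply: ler_sum => m _.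
rewrite -sumrB; apply: le_trans (ler_norm_sum _ _ _) _; apply: ler_sum => n _.
have [k hk] := sample_approx m iD; have [l hl] := sample_approx n iD.
rewrite -rounded_bern2 -(bern2Dz _ (l - k)).
apply: le_trans (bern2_lip _ _) _; rewrite intrB.
have -> : u m.+1 (grid M i) - u n.+1 (grid M i) + (l%:~R - k%:~R) -
    ((sample M m i)%:R / P%:R - (sample M n i)%:R / P%:R) =
  (u m.+1 (grid M i) - ((sample M m i)%:R / P%:R + k%:~R)) -
  (u n.+1 (grid M i) - ((sample M n i)%:R / P%:R + l%:~R)) by ring.
by apply: le_trans (ler_normB _ _) _; lra.
Qed.

Lemma selectedE M i :
  selected M i = (8 * (M ^ 4)%:R ^+ 2 / P%:R < rounded_energy M i).
Proof.
rewrite /selected /rounded_energy -(ltr_nat R) !natrD !natr_sum.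
set N := (M ^ 4)%N; pose dl m n : R := (dist_nat (sample M m i) (sample M n i))%:R.
have P0 : P%:R != 0 :> R by rewrite gt_eqF.
have -> : \sum_(m < N) \sum_(n < N) (let x := dl m n / P%:R in x ^+ 2 - x + 6^-1) =
   (\sum_(m < N) \sum_(n < N) (6 * dl m n ^+ 2 + P%:R ^+ 2) -
    \sum_(m < N) \sum_(n < N) (6 * P%:R * dl m n)) / (6 * P%:R ^+ 2).
  rewrite -sumrB mulr_suml; apply: eq_bigr => m _; rewrite -sumrB mulr_suml.
  by apply: eq_bigr => n _ /=; field.
rewrite ltr_pdivlMr ?mulr_gt0 ?exprn_gt0 // ltrBrDl.
congr (_ < _).
  congr (_ + _).
    apply: eq_bigr => m _; rewrite natr_sum; apply: eq_bigr => n _.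
    by rewrite !natrM.
  by rewrite !natrM natrX; field.
apply: eq_bigr => m _; rewrite natr_sum; apply: eq_bigr => n _.
by rewrite natrD natrM !natrX.
Qed.

Let grid01 M i : (i <= 2 ^ mesh M)%N -> grid M i \in `[0, 1].
Proof.
move=> iD; rewrite in_itv /= /grid divr_ge0 //= ler_pdivrMr ?ltr0n ?expn_gt0 //.
by rewrite mul1r ler_nat.
Qed.

Let mesh_largeR M :
  2 * (slope M)%:R * ((M ^ 4)%:R + 1) * P%:R <= (2 ^ mesh M)%:R :> R.
Proof. by have := mesh_large M; rewrite -(ler_nat R) 3!natrM natrD. Qed.

Let slope_ge0 M : 0 <= (slope M)%:R :> R. Proof. by []. Qed.

(** Markov's inequality: at a selected point the true energy exceeds [(8 - 4) N^2 / P], and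
    elsewhere it is nonnegative. With [N = M^4] and [Q = M^2] the mean is at most [M^6 (2 + 2/K)],
    so the selected proportion is at most [P (2 + 2/K) / (4 M^2)]. *)
Lemma selected_few (C : nat) M : (0 < M)%N -> 3 * P%:R * (2 + 2 / K) <= 4 * C%:R ->
  (3 * M ^ 2 * \sum_(i < 2 ^ mesh M) selected M i <= C * 2 ^ mesh M)%N.
Proof.
move=> M0 hC; rewrite -(ler_nat R) natrM (natrM _ 3) (natrX _ _ 2) (natrM _ C).
have MR : 1 <= M%:R :> R by rewrite ler1n.
have QE : ((M ^ 2) ^ 2 = M ^ 4)%N by rewrite -expnM.
have P1 : 1 <= P%:R :> R by rewrite ler1n expn_gt0.
set D := (2 ^ mesh M)%N; have D0 : (0 < D)%N by rewrite expn_gt0.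
have N0 : 0 <= (M ^ 4)%:R :> R by [].
have S0 := slope_ge0 M; have L0 := mesh_largeR M.
have := @mean_energy R u K (slope M)%:R (M ^ 2) D hK K0; rewrite expn_gt0 M0 QE.
move=> /(_ isT D0 _ _); set T := \sum_(i < D) _ => mean.
have {}mean : T <= D%:R * ((M ^ 2)%:R ^+ 3 * (2 + 2 / K)).
  apply: mean.
    by move=> [|n] t // nN t01; exact: slope_bound.
  apply: le_trans L0.
  have : (M ^ 2)%:R <= (M ^ 4)%:R + 1 :> R by rewrite natr1 ler_nat ltnW // ltnS leq_pexp2l.
  move=> q; rewrite -[leLHS]mulr1; by apply: ler_pM; rewrite ?ler_wpM2l ?mulr_ge0.
have low : (\sum_(i < D) selected M i)%:R * (4 * (M ^ 4)%:R ^+ 2 / P%:R) <= T.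
  rewrite natr_sum mulr_suml; apply: ler_sum => i _.
  have iD : (i <= 2 ^ mesh M)%N by exact: ltnW.
  have := sample_energy iD; rewrite ler_norml => /andP[h _].
  have := selectedE M i; case: (selected M i) => [|_]; last by rewrite mul0r energy_ge0.
  by move=> /esym; rewrite mul1r => h'; lra.
have := le_trans low mean.
set s : R := (\sum_(i < D) selected M i)%:R; rewrite [(M ^ 4)%:R]natrX [(M ^ 2)%:R]natrX.
set m : R := M%:R in MR *.
have m0 : 0 < m by lra.
have -> : 4 * (m ^+ 4) ^+ 2 / P%:R = m ^+ 6 * (4 * m ^+ 2 / P%:R) by ring.
have -> : D%:R * ((m ^+ 2) ^+ 3 * (2 + 2 / K)) = m ^+ 6 * (D%:R * (2 + 2 / K)) by ring.
rewrite mulrCA ler_pM2l ?exprn_gt0 // => h.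
have -> : 3 * m ^+ 2 * s = 3 * P%:R / 4 * (s * (4 * m ^+ 2 / P%:R)).
  by field; rewrite gt_eqF.
have c0 : 0 <= 3 * P%:R / 4 :> R by lra.
apply: le_trans (ler_wpM2l c0 h) _.
have -> : 3 * P%:R / 4 * (D%:R * (2 + 2 / K)) = D%:R * (3 * P%:R * (2 + 2 / K)) / 4 by ring.
rewrite ler_pdivrMr // (_ : C%:R * D%:R * 4 = D%:R * (4 * C%:R)); last by ring.
exact: ler_wpM2l.
Qed.

(** The 13 is 8 from the threshold, 4 from rounding and 1 from moving [x] to the nearby grid
    point. *)
Lemma not_selected_energy (x : R) M : x \in `[0, 1] -> ~ layer mesh selected M x ->
  energy (fun n => u n.+1 x) (M ^ 4) <= 13 / P%:R * (M ^ 4)%:R ^+ 2.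
Proof.
rewrite in_itv /= => /andP[x0 x1] hl.
set D := (2 ^ mesh M)%N; have DN : (0 < D)%N by rewrite expn_gt0.
have D0 : 0 < D%:R :> R by rewrite ltr0n.
have [i [iD xi1 xi2]] : exists i, [/\ (i < D)%N, i%:R <= x * D%:R & x * D%:R <= i%:R + 1].
  have xD : 0 <= x * D%:R by rewrite mulr_ge0 // ltW.
  have /andP[j1 j2] := truncn_itv xD.
  have [jD|Dj] := ltnP (Num.truncn (x * D%:R)) D.
    by exists (Num.truncn (x * D%:R)); split => //; rewrite natr1 ltW.
  (* Only [x = 1] gets here; it belongs to the last closed cell. *)
  exists D.-1; split; first by rewrite prednK.
    by apply: le_trans j1; rewrite ler_nat; lia.
  by rewrite natr1 prednK // ler_piMl // ltW.
have nsel : ~~ selected M i.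
  apply/negP => si; apply: hl; exists i; split => //.
  rewrite /cell /= in_itv /= ltr_pdivrMr // ltr_pdivlMr // -/D; apply/andP; lra.
have iD' : (i <= 2 ^ mesh M)%N by exact: ltnW.
have := sample_energy iD'; rewrite ler_norml => /andP[_ h1].
move: nsel; rewrite selectedE -leNgt => h2.
have t01 := grid01 iD'; set t := grid M i in t01 h1 h2.
have tx : `|x - t| <= D%:R^-1.
  rewrite -(ler_pM2r D0) mulVf ?gt_eqF // -{1}(ger0_norm (ltW D0)) -normrM mulrBl.
  by rewrite /t /grid divfK ?gt_eqF // ler_norml; apply/andP; lra.
have [cd _ _] := hK.
have lip (f g : R -> R) : continuously_differentiable01 f -> continuously_differentiable01 g ->
    (forall r, r \in `[0, 1] -> `|deriv01 f r| <= (slope M)%:R) ->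
    (forall r, r \in `[0, 1] -> `|deriv01 g r| <= (slope M)%:R) ->
    forall a b, 0 <= a -> a < b -> b <= 1 ->
    `|(f b - g b) - (f a - g a)| <= 2 * (slope M)%:R * `|b - a|.
  move=> [df _] [dg _] hf hg a b a0 ab b1.
  have [c /andP[ac cb] ->] := MVT01 df dg a0 ab b1.
  have c01 : c \in `[0, 1] by rewrite in_itv /=; apply/andP; lra.
  rewrite normrM ler_wpM2r // (le_trans (ler_normB _ _)) //.
  by have := hf c c01; have := hg c c01; lra.
have close m n : (m < M ^ 4)%N -> (n < M ^ 4)%N ->
   `|(u m.+1 x - u n.+1 x) - (u m.+1 t - u n.+1 t)| <= P%:R^-1.
  move=> mN nN.
  have : `|(u m.+1 x - u n.+1 x) - (u m.+1 t - u n.+1 t)| <= 2 * (slope M)%:R * `|x - t|.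
    have l := lip _ _ (cd m.+1 isT) (cd n.+1 isT)
      (fun r => slope_bound mN) (fun r => slope_bound nN).
    move: t01; rewrite in_itv /= => /andP[t0 t1].
    have [xt|tx'|->] := ltgtP x t.
    - by rewrite distrC [`|x - t|]distrC; apply: l.
    - by apply: l.
    - by rewrite !subrr normr0 mulr0.
  move=> /le_trans; apply.
  apply: (@le_trans _ _ (2 * (slope M)%:R * D%:R^-1)); first by rewrite ler_wpM2l ?mulr_ge0.
  rewrite ler_pdivrMr // ler_pdivlMl // mulrC; apply: le_trans (mesh_largeR M).
  apply: ler_wpM2r; first exact: ltW.
  by rewrite ler_peMr ?mulr_ge0 // lerDr.
have h3 : energy (fun n => u n.+1 x) (M ^ 4) - energy (fun n => u n.+1 t) (M ^ 4)
    <= (M ^ 4)%:R ^+ 2 / P%:R.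
  have -> : (M ^ 4)%:R ^+ 2 / P%:R = \sum_(m < M ^ 4) \sum_(n < M ^ 4) (P%:R^-1) :> R.
    by rewrite !sumr_const card_ord -mulrnA -[_ *+ (_ * _)]mulr_natl natrM.
  rewrite /energy -sumrB; apply: ler_sum => m _; rewrite -sumrB; apply: ler_sum => n _.
  apply: le_trans (ler_norm _) _; apply: le_trans (bern2_lip _ _) _.
  exact: close.
have -> : 13 / P%:R * (M ^ 4)%:R ^+ 2 = 13 * ((M ^ 4)%:R ^+ 2 / P%:R) :> R by ring.
move: h1 h2 h3; rewrite -!mulrA; lra.
Qed.

End Test.
End KoksmaTest.

Lemma schnorr_energy (R : realType) (x : R) (u : nat -> R -> R) (eps : R) :
  x \in `[0, 1] -> schnorr_random x -> effective_koksma u -> 0 < eps ->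
  exists M0, forall M, (M0 <= M)%N ->
    energy (fun n => u n.+1 x) (M ^ 4) <= eps * (M ^ 4)%:R ^+ 2.
Proof.
move=> x01 xS [[K K0 hK] hu hd] eps0.
pose p := (Num.truncn (13 / eps)).+1.
have P0 : 0 < (2 ^ p)%:R :> R by rewrite ltr0n expn_gt0.
have hp : 13 / (2 ^ p)%:R <= eps.
  rewrite ler_pdivrMr // mulrC -ler_pdivrMr //; apply: (le_trans (ltW (truncnS_gt _))).
  by rewrite ler_nat; apply: ltnW; exact: ltn_expl.
have [cd _ _] := hK.
have [B hB] := bounded01 (cd 1%N isT).2.
have [val cval hval] := grid_values p hu.
(* Precision [2 ^- 0 = 1] is enough, and the mesh with exponent 0 consists of the two endpoints. *)
have [der cder hder] := grid_values 0 hd.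
have bound n i t : (i <= 1)%N -> t = i%:R -> `|deriv01 (u n.+1) t| <= (der n 0%N i)%:R + 1.
  move=> i1 ->; have := hder n 0%N i i1; rewrite expn0 divr1 expr0 invr1 => h.
  have := decode_rat_le R (der n 0%N i).
  have := ler_normD (deriv01 (u n.+1) i%:R - ratr (decode_rat (der n 0%N i)))
    (ratr (decode_rat (der n 0%N i))).
  by rewrite subrK; lra.
have cder' i : comp_fun 1 (fun v => der (nth 0 v 0) 0 i)%N.
  by apply: (comp_app3 cder); comp_auto.
pose C := (Num.truncn (3 * (2 ^ p)%:R * (2 + 2 / K))).+1.
have hC : 3 * (2 ^ p)%:R * (2 + 2 / K) <= 4 * C%:R.
  apply: (le_trans (ltW (truncnS_gt _))); rewrite -/C.
  by have := ler0n R C; lra.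
pose d0 n := der n 0%N 0%N; pose d1 n := der n 0%N 1%N.
have h0 n : `|deriv01 (u n.+1) 0| <= (d0 n)%:R + 1 by exact: bound.
have h1 n : `|deriv01 (u n.+1) 1| <= (d1 n)%:R + 1 by exact: bound.
have [||M0 HM0] := @schnorr_avoids (mesh p B d0 d1) (selected p B d0 d1 val)
  (comp_mesh p B (cder' 0%N) (cder' 1%N)) (comp_selected p B (cder' 0%N) (cder' 1%N) cval)
  C R _ _ x xS.
- exact: mesh_mono.
- by move=> M M0; exact: (selected_few hK K0 hB h0 h1 hval).
exists M0 => M /HM0 hM.
apply: le_trans (not_selected_energy hK K0 hB h0 h1 hval x01 hM) _.
by rewrite ler_wpM2r ?exprn_ge0.
Qed.

Theorem theorem1 (R : realType) (x : R) (hx : x \in `[0, 1]) :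
  (schnorr_random x -> effective_koksma_ud x) /\
  (martin_lof_random x -> effective_koksma_ud x).
Proof.
have S : schnorr_random x -> effective_koksma_ud x.
  move=> xS u hu a b a0 ab b1; apply/cvgrPdist_le => e e0.
  have sm eps : 0 < eps -> exists M0, forall M, (M0 <= M)%N ->
      energy (fun n => u n.+1 x) (M ^ 4) <= eps * (M ^ 4)%:R ^+ 2.
    exact: schnorr_energy.
  have [N0 HN0] := energy_ud sm a0 (ltW ab) b1 e0.
  exists N0 => // N /= /HN0.
  (* The sequence is indexed from 1, the energy and its counts from 0. *)
  by rewrite (iotaDl 1 0 N : iota 1 N = _) count_map.
split=> // xML; apply: S => U [UML _]; exact: xML.
Qed.
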